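(* Let $c_0\in\mathbb{R}$. The map $\mathrm{G}\beta:\mathrm{GVect}_{\mathrm{ar}}(D^2)\times\mathrm{GVect}_{\mathrm{ar}}(D^2)\to\mathbb{R}$, $$(\mathrm{G}\beta)(V,W)=-6c_0\int_{D^2}\mathrm{tr}\left(dJ_{D^2}(V)\wedge dJ_{D^2}(W)\right),$$ is a Lie algebra $2$-cocycle of $\mathrm{GVect}_{\mathrm{ar}}(D^2)$.
   Context: $D^2$ is the open unit disc in $\mathbb{R}^2$, $S^1=\partial D^2$. A vector field $V=V_1\frac{\partial}{\partial x}+V_2\frac{\partial}{\partial y}$ with $V_1,V_2\in C^\infty(D^2;\mathbb{R})$ is written in polar coordinates on $D^2\setminus\{0\}$ as $V=V_3(r,\theta)\frac{\partial}{\partial r}+V_4(r,\theta)\frac{\partial}{\partial\theta}$. $\mathrm{GVect}_{\mathrm{ar}}(D^2)$ is the real Lie algebra, under the usual commutator of vector fields, of those $V$ for which $V_1,V_2$ extend continuously to $\overline{D^2}$ and $\partial_rV_3\equiv0\equiv\partial_rV_4$ on some neighborhood of $S^1$ in $\overline{D^2}$ (no tangency to $S^1$ is required). $J_{D^2}(V)=\begin{pmatrix}\partial_xV_1&\partial_yV_1\\ \partial_xV_2&\partial_yV_2\end{pmatrix}$; $\wedge$ of matrix-valued forms combines matrix product and wedge product; $\mathrm{tr}$ is the matrix trace. A Lie algebra $2$-cocycle of $\mathfrak{g}$ is a skew-symmetric $\mathbb{R}$-bilinear $\beta:\mathfrak{g}\times\mathfrak{g}\to\mathbb{R}$ with $\beta([V,W],U)+\beta([W,U],V)+\beta([U,V],W)=0$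 for all $V,W,U\in\mathfrak{g}$. *)

(* Defs.v *)
From HB Require Import structures.
From mathcomp Require Import all_boot all_order all_algebra.
From mathcomp Require Import all_classical all_reals all_analysis.

Set Implicit Arguments.
Unset Strict Implicit.
Unset Printing Implicit Defensive.

Import Order.TTheory GRing.Theory Num.Theory.
Import numFieldNormedType.Exports.

Local Open Scope classical_set_scope.
Local Open Scope ring_scope.

Definition disc (R : realType) : set (R * R) :=
  [set p | p.1 ^+ 2 + p.2 ^+ 2 < 1].

Definition closed_disc (R : realType) : set (R * R) :=
  [set p | p.1 ^+ 2 + p.2 ^+ 2 <= 1].

Definition circle (R : realType) : set (R * R) :=
  [set p | p.1 ^+ 2 + p.2 ^+ 2 = 1].

Definition vec2 (R : realType) (a b : R) : 'rV[R]_2 :=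
  \row_j (if j == 0 then a else b).

Definition direction (R : realType) (j : 'I_2) : R * R :=
  if j == 0 then (1, 0) else (0, 1).

Definition partial (R : realType) (j : 'I_2) (f : R * R -> R) : R * R -> R :=
  fun p => 'D_(direction R j) f p.

(* Meaningful for open [U]: the existence of the partial derivatives and their
   values at points of [U] only depend on [f] on [U]. *)
Fixpoint Ck (R : realType) (k : nat) (U : set (R * R)) (f : R * R -> R) : Prop :=
  (forall p, U p -> {for p, continuous f}) /\
  (if k is k'.+1 then
     forall j : 'I_2, (forall p, U p -> derivable f p (direction R j)) /\
                      Ck k' U (partial j f)
   else True).

Definition Cinfty (R : realType) (U : set (R * R)) (f : R * R -> R) : Prop :=
  forall k : nat, Ck k U f.

Definition vfield (R : realType) := R * R -> 'rV[R]_2.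

Definition vcomp (R : realType) (V : vfield R) (i : 'I_2) : R * R -> R :=
  fun p => V p 0 i.

(* [V, W]_i = \sum_j (V_j \partial_j W_i - W_j \partial_j V_i), that is, the
   commutator V W - W V of the associated derivations. *)
Definition bracket (R : realType) (V W : vfield R) : vfield R :=
  fun p => \row_i \sum_(j < 2)
    (vcomp V j p * partial j (vcomp W i) p - vcomp W j p * partial j (vcomp V i) p).

Definition polar (R : realType) (r t : R) : R * R := (r * cos t, r * sin t).

(* The frame \partial/\partial r, \partial/\partial\theta, as the derivatives of
   [polar] with respect to [r] and to [t]. *)
Definition d_r (R : realType) (t : R) : 'rV[R]_2 := vec2 (cos t) (sin t).
Definition d_theta (R : realType) (r t : R) : 'rV[R]_2 :=
  vec2 (- (r * sin t)) (r * cos t).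

(* V = V3 \partial/\partial r + V4 \partial/\partial\theta on the punctured disc;
   this determines V3 r t and V4 r t for all 0 < r < 1 and all t. *)
Definition polar_form (R : realType) (V : vfield R) (V3 V4 : R -> R -> R) : Prop :=
  forall r t : R, 0 < r < 1 ->
    V (polar r t) = V3 r t *: d_r t + V4 r t *: d_theta r t.

(* The radial derivatives vanish on N minus S^1 for a neighborhood N of S^1.
   Nothing is to be added on S^1: V3 and V4 are then locally constant in r inside
   N, hence so are their continuous extensions up to r = 1. *)
Definition radially_constant_near_circle (R : realType) (V : vfield R) : Prop :=
  exists V3 V4 : R -> R -> R, polar_form V V3 V4 /\
    exists2 N : set (R * R), set_nbhs (@circle R) N &
      forall r t : R, 0 < r < 1 -> N (polar r t) ->
        is_derive r 1 (V3 ^~ t) 0 /\ is_derive r 1 (V4 ^~ t) 0.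

(* A vector field on the open disc is represented by its extension by 0 to the
   plane, so that equality of elements is equality on the disc; linear operations
   and [bracket] preserve this convention. *)
Record GVect_ar (R : realType) (V : vfield R) : Prop := {
  GVect_ar_out : forall p, ~ disc p -> V p = 0;
  GVect_ar_smooth : forall i : 'I_2, Cinfty (@disc R) (vcomp V i);
  GVect_ar_extends : exists Vbar : vfield R,
    {within @closed_disc R, continuous Vbar} /\
    (forall p, disc p -> Vbar p = V p);
  GVect_ar_radial : radially_constant_near_circle V }.

(* [g] is closed under the operations of the Lie algebra of vector fields. *)
Record lie_subalgebra (R : realType) (g : vfield R -> Prop) : Prop := {
  lie_subalgebra0 : g (0 : R * R -> 'rV[R]_2);
  lie_subalgebra_lin : forall (a : R) (V W : R * R -> 'rV[R]_2),
    g V -> g W -> g (a *: V + W);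
  lie_subalgebra_bracket : forall V W, g V -> g W -> g (bracket V W) }.

Record lie_2cocycle (R : realType) (g : vfield R -> Prop)
    (beta : vfield R -> vfield R -> R) : Prop := {
  cocycle_skew : forall V W, g V -> g W -> beta V W = - beta W V;
  cocycle_linl : forall (a : R) (U V W : R * R -> 'rV[R]_2),
    g U -> g V -> g W -> beta (a *: U + V) W = a * beta U W + beta V W;
  cocycle_linr : forall (a : R) (U V W : R * R -> 'rV[R]_2),
    g U -> g V -> g W -> beta W (a *: U + V) = a * beta W U + beta W V;
  cocycle_cyclic : forall V W U, g V -> g W -> g U ->
    beta (bracket V W) U + beta (bracket W U) V + beta (bracket U V) W = 0 }.

Definition jac (R : realType) (V : vfield R) : R * R -> 'M[R]_2 :=
  fun p => \matrix_(i, j) partial j (vcomp V i) p.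

(* A matrix-valued 1-form A_0 dx + A_1 dy is given by its coefficients. *)
Definition mx_form1 (R : realType) := 'I_2 -> R * R -> 'M[R]_2.

Definition dmx (R : realType) (A : R * R -> 'M[R]_2) : mx_form1 R :=
  fun k p => \matrix_(i, j) partial k (fun q => A q i j) p.

(* The coefficient of dx /\ dy. *)
Definition wedge (R : realType) (A B : mx_form1 R) : R * R -> 'M[R]_2 :=
  fun p => A 0 p *m B 1 p - A 1 p *m B 0 p.

Definition Gbeta_density (R : realType) (V W : vfield R) : R * R -> R :=
  fun p => \tr (wedge (dmx (jac V)) (dmx (jac W)) p).

Definition lebesgue2 (R : realType) :=
  (@lebesgue_measure R \x @lebesgue_measure R)%E.
Arguments lebesgue2 R : clear implicits.

Definition Gbeta (R : realType) (c0 : R) (V W : vfield R) : R :=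
  - 6 * c0 * \int[lebesgue2 R]_(p in @disc R) Gbeta_density V W p.

(* Main.v *)
Require Import Defs.
From mathcomp Require Import all_boot all_order all_algebra.
From mathcomp Require Import all_classical all_reals all_analysis.
From mathcomp Require Import ring lra.

(* Near the circle write V = f e + g t, where e = x d/dx + y d/dy and
   t = - y d/dx + x d/dy; the radial condition says that f and g are homogeneous of
   degrees -1 and 0.  Since e and t commute, Euler's relation gives
   [f e + g t, f' e + g' t] = (g t(f') - g' t(f)) e + (g t(g') - g' t(g)) t,
   so the condition is stable under brackets; homogeneity also bounds all derivatives
   up to the circle, whence the integrability.
   In tr(dJ_[V,W] /\ dJ_U) + cyclic, the terms of J_[V,W] algebraic in J_V and J_W
   cancel, and what remains is the divergence of the vector field
   F = V tr(dJ_W /\ dJ_U) + cyclic.  Near the circle r^2 tr(dJ_V /\ dJ_W) has the form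
   f_W c_V - f_V c_W with c_V depending on V alone, so F is tangent to the circles
   centred at 0.  Hence, for a radial cutoff h equal to 1 away from the circle,
   h div F = div (h F) has integral zero, and dominated convergence concludes. *)

Set Implicit Arguments.
Unset Strict Implicit.
Unset Printing Implicit Defensive.

Import Order.TTheory GRing.Theory Num.Theory.
Import numFieldNormedType.Exports.

Local Open Scope classical_set_scope.
Local Open Scope ring_scope.

(** * Smooth functions of two variables *)

Section Ck.
Variable R : realType.
Implicit Types (U : set (R * R)) (f g : R * R -> R) (p : R * R) (j : 'I_2).

(** No boundary condition is imposed on the fields, so F need not vanish on the circle: only its
    tangency removes the boundary term. The gradient of a radial cutoff h is a multiple of e, and it
    grows as the transition layer shrinks; since F . e is exactly 0 on that layer, no estimate of
    the gradient is needed, and 0 <= h <= 1 is all that dominated convergence uses. The divergence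
    of F contains third derivatives of the fields. Its integrability does not come from bounds on
    them but from the closure under brackets: div F is a sum of three densities of elements of the
    algebra, and a density only involves second derivatives. Homogeneity is a relation between two
    points of an annulus inside the open disc, where the fields are smooth. It takes the place of
    polar coordinates in the computations: all derivatives stay Cartesian, Euler's relation carries
    the radial information, and each pointwise identity becomes a polynomial or rational identity
    between the values of derivatives at one point. *)

Lemma partial_ext U f g j p : open U -> U p -> (forall q, U q -> f q = g q) ->
  partial j f p = partial j g p.
Proof.
move=> oU Up fg; apply: near_eq_derive.
by apply: filterS (open_nbhs_nbhs (conj oU Up)).
Qed.

Lemma derivable_ext U f g v p : open U -> U p ->
  (forall q, U q -> f q = g q) -> derivable f p v -> derivable g p v.
Proof.
move=> oU Up fg; apply: near_eq_derivable.
by apply: filterS (open_nbhs_nbhs (conj oU Up)).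
Qed.

Lemma continuous_ext U f g p : open U -> U p ->
  (forall q, U q -> f q = g q) -> {for p, continuous f} -> {for p, continuous g}.
Proof.
move=> oU Up fg cf; rewrite /prop_for /continuous_at -fg//.
apply: cvg_trans cf; apply: near_eq_cvg.
by apply: filterS (open_nbhs_nbhs (conj oU Up)).
Qed.

(** Derivatives of sums, products and inverses are known by formula on [U] only; each closure proof
    below uses this to put the formula in place of the derivative. *)
Lemma Ck_ext k U f g : open U -> (forall p, U p -> f p = g p) ->
  Ck k U f -> Ck k U g.
Proof.
move=> oU; elim: k f g => [|k IH] f g fg /= [cf df]; split=> //.
- by move=> p Up; exact: (continuous_ext oU Up fg (cf _ Up)).
- by move=> p Up; exact: (continuous_ext oU Up fg (cf _ Up)).
- move=> j; have [df1 df2] := df j; split.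
    by move=> p Up; exact: (derivable_ext oU Up fg (df1 _ Up)).
  by apply: IH df2 => p Up; exact: (partial_ext j oU Up fg).
Qed.

Lemma Ck_sub k U U' f : U' `<=` U -> Ck k U f -> Ck k U' f.
Proof.
move=> UU; elim: k f => [|k IH] f /= [cf df]; split=> //.
- by move=> p /UU /cf.
- by move=> p /UU /cf.
- by move=> j; have [df1 df2] := df j; split; [move=> p /UU /df1|exact: IH].
Qed.

Lemma CkS k U f : Ck k.+1 U f -> Ck k U f.
Proof.
elim: k f => [|k IH] f [cf df]; first by split.
by split=> // j; have [df1 df2] := df j; split=> //; exact: IH.
Qed.

Lemma Ck_cst k U (c : R) : open U -> Ck k U (fun=> c).
Proof.
move=> oU; elim: k c => [|k IH] c /=; split=> //; try by move=> p _; exact: cvg_cst.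
move=> j; split; first by move=> p _; exact: derivable_cst.
apply: (Ck_ext oU _ (IH 0)) => p Up.
by rewrite /partial derive_cst.
Qed.

Lemma partialD f g j p : derivable f p (direction R j) -> derivable g p (direction R j) ->
  partial j (fun q => f q + g q) p = partial j f p + partial j g p.
Proof. by move=> df dg; rewrite /partial -deriveD. Qed.

Lemma partialM f g j p : derivable f p (direction R j) -> derivable g p (direction R j) ->
  partial j (fun q => f q * g q) p = f p * partial j g p + g p * partial j f p.
Proof. by move=> df dg; rewrite /partial; have := deriveM df dg. Qed.

Lemma CkD k U f g : open U -> Ck k U f -> Ck k U g -> Ck k U (fun q => f q + g q).
Proof.
move=> oU; elim: k f g => [|k IH] f g [cf df] [cg dg]; split=> //;
  try by move=> p Up; apply: cvgD; [exact: cf|exact: cg].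
move=> j; have [df1 df2] := df j; have [dg1 dg2] := dg j; split.
  by move=> p Up; apply: derivableD; [exact: df1|exact: dg1].
apply: (Ck_ext oU _ (IH _ _ df2 dg2)) => p Up.
by rewrite partialD//; [exact: df1|exact: dg1].
Qed.

Lemma CkM k U f g : open U -> Ck k U f -> Ck k U g -> Ck k U (fun q => f q * g q).
Proof.
move=> oU; elim: k f g => [|k IH] f g Cf Cg; move: (Cf) (Cg) => [cf df] [cg dg]; split=> //;
  try by move=> p Up; apply: cvgM; [exact: cf|exact: cg].
move=> j; have [df1 df2] := df j; have [dg1 dg2] := dg j; split.
  by move=> p Up; apply: derivableM; [exact: df1|exact: dg1].
apply: (Ck_ext oU _ (CkD oU (IH _ _ (CkS Cf) dg2) (IH _ _ (CkS Cg) df2))) => p Up.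
by rewrite partialM//; [exact: df1|exact: dg1].
Qed.

Lemma CkV k U f : open U -> (forall p, U p -> f p != 0) -> Ck k U f -> Ck k U (fun q => (f q)^-1).
Proof.
move=> oU f0; elim: k => [|k IH] Cf; move: (Cf) => [cf df]; split=> //;
  try by move=> p Up; apply: cvgV; [exact: f0|exact: cf].
move=> j; have [df1 df2] := df j; split.
  by move=> p Up; apply: derivableV; [exact: f0|exact: df1].
(* The derivative -(1/f)^2 df contains 1/f again, but at one order less, where the induction
   hypothesis applies. *)
have H := CkM oU (Ck_cst k (-1) oU) (CkM oU (CkM oU (IH (CkS Cf)) (IH (CkS Cf))) df2).
apply: (Ck_ext oU _ H) => p Up.
rewrite /partial deriveV; [|exact: f0|exact: df1].
by rewrite /GRing.scale/= mulN1r expr2 invfM mulNr.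
Qed.

Lemma Cinfty_ext U f g : open U -> (forall p, U p -> f p = g p) ->
  Cinfty U f -> Cinfty U g.
Proof. by move=> oU fg Cf k; exact: Ck_ext (Cf k). Qed.

Lemma Cinfty_sub U U' f : U' `<=` U -> Cinfty U f -> Cinfty U' f.
Proof. by move=> UU Cf k; exact: Ck_sub (Cf k). Qed.

Lemma Cinfty_cst U (c : R) : open U -> Cinfty U (fun=> c).
Proof. by move=> oU k; exact: Ck_cst. Qed.

Lemma CinftyD U f g : open U -> Cinfty U f -> Cinfty U g -> Cinfty U (fun q => f q + g q).
Proof. by move=> oU Cf Cg k; exact: CkD. Qed.

Lemma CinftyM U f g : open U -> Cinfty U f -> Cinfty U g -> Cinfty U (fun q => f q * g q).
Proof. by move=> oU Cf Cg k; exact: CkM. Qed.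

Lemma CinftyN U f : open U -> Cinfty U f -> Cinfty U (fun q => - f q).
Proof.
move=> oU Cf; apply: (Cinfty_ext oU _ (CinftyM oU (Cinfty_cst (-1) oU) Cf)) => p _.
by rewrite mulN1r.
Qed.

Lemma CinftyB U f g : open U -> Cinfty U f -> Cinfty U g -> Cinfty U (fun q => f q - g q).
Proof. by move=> oU Cf Cg; exact: (CinftyD oU Cf (CinftyN oU Cg)). Qed.

Lemma CinftyV U f : open U -> (forall p, U p -> f p != 0) -> Cinfty U f ->
  Cinfty U (fun q => (f q)^-1).
Proof. by move=> oU f0 Cf k; exact: CkV. Qed.

Lemma Cinfty_partial U f j : Cinfty U f -> Cinfty U (partial j f).
Proof. by move=> Cf k; have [_ /(_ j)[]] := Cf k.+1. Qed.

Lemma Cinfty_continuous U f p : Cinfty U f -> U p -> {for p, continuous f}.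
Proof. by move=> /(_ 0%N)[+ _]; exact. Qed.

Lemma Cinfty_derivable U f j p : Cinfty U f -> U p -> derivable f p (direction R j).
Proof. by move=> /(_ 1%N)[_ /(_ j)[+ _]]; exact. Qed.

(** * The coordinate functions *)

Lemma partial_fst j p : partial j (fun q => q.1) p = (j == 0)%:R.
Proof.
apply: cvg_lim => //; apply: cvg_near_cst; near=> h.
rewrite /= addrK /direction /GRing.scale/=.
have h0 : h != 0 by near: h; exact: nbhs_dnbhs_neq.
by case: (j == 0) => /=; rewrite ?mulr0// mulr1 mulVf.
Unshelve. all: by end_near. Qed.

Lemma partial_snd j p : partial j (fun q => q.2) p = (j != 0)%:R.
Proof.
apply: cvg_lim => //; apply: cvg_near_cst; near=> h.
rewrite /= addrK /direction /GRing.scale/=.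
have h0 : h != 0 by near: h; exact: nbhs_dnbhs_neq.
by case: (j == 0) => /=; rewrite ?mulr0// mulr1 mulVf.
Unshelve. all: by end_near. Qed.

Lemma derivable_fst p v : derivable (fun q : R * R => q.1) p v.
Proof.
apply/cvg_ex; exists v.1; apply: cvg_near_cst; near=> h.
have h0 : h != 0 by near: h; exact: nbhs_dnbhs_neq.
by rewrite /= addrK /GRing.scale/= mulKf.
Unshelve. all: by end_near. Qed.

Lemma derivable_snd p v : derivable (fun q : R * R => q.2) p v.
Proof.
apply/cvg_ex; exists v.2; apply: cvg_near_cst; near=> h.
have h0 : h != 0 by near: h; exact: nbhs_dnbhs_neq.
by rewrite /= addrK /GRing.scale/= mulKf.
Unshelve. all: by end_near. Qed.

Lemma continuous_fst_at p : {for p, continuous (fun q : R * R => q.1)}.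
Proof. exact: cvg_fst. Qed.

Lemma Cinfty_fst U : open U -> Cinfty U (fun q => q.1).
Proof.
move=> oU [|k].
  by split; [move=> p _; exact: continuous_fst_at|exact: I].
split; first by move=> p _; exact: continuous_fst_at.
move=> j; split; first by move=> p _; exact: derivable_fst.
by apply: (Ck_ext oU _ (Ck_cst k (j == 0)%:R oU)) => p _; rewrite partial_fst.
Qed.

Lemma continuous_snd_at p : {for p, continuous (fun q : R * R => q.2)}.
Proof. exact: cvg_snd. Qed.

Lemma Cinfty_snd U : open U -> Cinfty U (fun q => q.2).
Proof.
move=> oU [|k].
  by split; [move=> p _; exact: continuous_snd_at|exact: I].
split; first by move=> p _; exact: continuous_snd_at.
move=> j; split; first by move=> p _; exact: derivable_snd.
by apply: (Ck_ext oU _ (Ck_cst k (j != 0)%:R oU)) => p _; rewrite partial_snd.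
Qed.

End Ck.

(** * Differentiability and symmetry of second derivatives *)

Section Differential.
Variable R : realType.
Implicit Types (U : set (R * R)) (f g : R * R -> R) (p q v : R * R) (j k : 'I_2).

(** The two difference quotients are the same function of h; this is the bridge to one-variable
    calculus. *)
Lemma is_derive_line f p v (t : R) : derivable f (p + t *: v) v ->
  is_derive t 1 (fun s => f (p + s *: v)) ('D_v f (p + t *: v)).
Proof.
have E : (fun h : R => h^-1 *: (((fun s => f (p + s *: v)) \o shift t) (h *: 1) - f (p + t *: v)))
       = (fun h : R => h^-1 *: ((f \o shift (p + t *: v)) (h *: v) - f (p + t *: v))).
  apply/funext => h /=; congr (_ *: (f _ - _)).
  by rewrite scalerDl /GRing.scale/= mulr1 addrCA.
move=> df; apply: DeriveDef; first by rewrite /derivable E.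
by rewrite /derive E.
Qed.

(** The increment [s] may be negative, hence the two cases and a point [c] located only by its
    absolute value. *)
Lemma mvt_dir f j p (s : R) :
  (forall t : R, `|t| <= `|s| -> derivable f (p + t *: direction R j) (direction R j)) ->
  exists2 c : R, `|c| <= `|s| &
    f (p + s *: direction R j) - f p = s * partial j f (p + c *: direction R j).
Proof.
move=> df; set e := direction R j in df *.
have D (t : R) : `|t| <= `|s| -> is_derive t 1 (fun s => f (p + s *: e)) ('D_e f (p + t *: e)).
  by move=> /df; exact: is_derive_line.
have cont (a b : R) : (forall t, t \in `[a, b] -> `|t| <= `|s|) ->
    {within `[a, b], continuous (fun s => f (p + s *: e))}.
  move=> H; apply: derivable_within_continuous => t /H ts.
  by have := D _ ts; case.
have f0 : f (p + 0 *: e) = f p by rewrite scale0r addr0.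
have [s0|s0] := leP 0 s.
- have H (t : R) : t \in `[0, s] -> `|t| <= `|s|.
    by rewrite in_itv/= => /andP[t0 ts]; rewrite !ger0_norm.
  have [c /H cs] := MVT_segment s0 (fun t ts => D t (H t (subset_itv_oo_cc ts))) (cont _ _ H).
  by rewrite f0 subr0 mulrC => ->; exists c.
- have H (t : R) : t \in `[s, 0] -> `|t| <= `|s|.
    by rewrite in_itv/= => /andP[t0 ts]; rewrite !ler0_norm ?lerN2// ltW.
  have [c /H cs] := MVT_segment (ltW s0) (fun t ts => D t (H t (subset_itv_oo_cc ts))) (cont _ _ H).
  rewrite f0 sub0r mulrN => E; exists c => //.
  by rewrite -[LHS]opprB E opprK mulrC.
Qed.

Lemma comb_dir (a b : R) p :
  p + (a *: direction R 0 + b *: direction R 1) = (p.1 + a, p.2 + b).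
Proof.
have -> : a *: direction R 0 = (a, 0).
  by congr (_, _); rewrite /= /GRing.scale/= ?mulr1 ?mulr0.
have -> : b *: direction R 1 = (0, b).
  by congr (_, _); rewrite /= /GRing.scale/= ?mulr1 ?mulr0.
by congr (_, _); rewrite /= ?addr0 ?add0r.
Qed.

Lemma nbhs_box p (A : set (R * R)) : nbhs p A ->
  exists2 d : R, 0 < d & forall a b : R, `|a| < d -> `|b| < d ->
    A (p + (a *: direction R 0 + b *: direction R 1)).
Proof.
move=> /nbhs_ballP[d /= d0 dA]; exists d => // a b ad bd; apply: dA.
by rewrite comb_dir; split; rewrite /= /ball/= opprD addrA subrr sub0r normrN.
Qed.

Lemma norm_scale_lt (d h x y : R) : `|h| < d / (`|x| + `|y| + 1) -> `|h * x| < d.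
Proof.
move=> hd; have x1 : 0 < `|x| + `|y| + 1 by rewrite ltr_wpDl// addr_ge0.
rewrite normrM; move: hd; rewrite ltr_pdivlMr//; apply: le_lt_trans.
by rewrite ler_wpM2l// -addrA lerDl addr_ge0.
Qed.

Lemma pair_dir p v (h : R) :
  p + h *: v = p + ((h * v.1) *: direction R 0 + (h * v.2) *: direction R 1).
Proof.
by rewrite comb_dir.
Qed.

(** The increment along [v] is split into one step along each axis, with the mean value theorem on
    each. Directions other than the axes occur below: the Euler field and rescaled axes. *)
Lemma C1_is_derive U f p v : open U -> Ck 1 U f -> U p ->
  is_derive p v f (v.1 * partial 0 f p + v.2 * partial 1 f p).
Proof.
move=> oU [_ df] Up.
suff H : (h^-1 *: ((f \o shift p) (h *: v) - f p)) @[h --> 0^'] -->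
    v.1 * partial 0 f p + v.2 * partial 1 f p.
  by apply: DeriveDef; [apply/cvg_ex; eexists; exact: H|exact: (cvg_lim _ H)].
apply/cvgrPdist_le => /= eps eps0.
(* The [+ 1] keeps the denominator positive when [v] is 0. *)
set e := eps / (`|v.1| + `|v.2| + 1).
have n0 : 0 < `|v.1| + `|v.2| + 1 by rewrite ltr_wpDl// addr_ge0.
have e0 : 0 < e by rewrite divr_gt0.
have [d0 [c0 _]] := df 0; have [d1 [c1 _]] := df 1.
have N0 : \forall q \near p, `|partial 0 f p - partial 0 f q| <= e.
  by have /cvgrPdist_le := c0 _ Up; apply.
have N1 : \forall q \near p, `|partial 1 f p - partial 1 f q| <= e.
  by have /cvgrPdist_le := c1 _ Up; apply.
have NU : \forall q \near p, U q by apply: open_nbhs_nbhs.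
have [d dgt0 dP] := nbhs_box (filterI NU (filterI N0 N1)).
near=> h.
have h0 : h != 0 by near: h; exact: nbhs_dnbhs_neq.
have hd : `|h| < d / (`|v.1| + `|v.2| + 1).
  near: h; apply: nbhs_dnbhs.
  exists (d / (`|v.1| + `|v.2| + 1)); first by rewrite /= divr_gt0.
  by move=> z; rewrite /ball/= sub0r normrN.
have hd1 := norm_scale_lt hd.
have hd2 : `|h * v.2| < d.
  by apply: (@norm_scale_lt _ _ _ v.1); rewrite (addrC `|v.2|).
rewrite /= (addrC (h *: v)) pair_dir.
set p2 := p + (h * v.2) *: direction R 1.
have [a ah Ea] : exists2 a : R, `|a| <= `|h * v.1| & f (p2 + (h * v.1) *: direction R 0) - f p2
    = (h * v.1) * partial 0 f (p2 + a *: direction R 0).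
  apply: mvt_dir => t th; apply: d0; rewrite /p2 -addrA (addrC (_ *: direction R 1)).
  by apply: (dP _ _ _ _).1 => //; exact: le_lt_trans hd1.
have [b bh Eb] : exists2 b : R, `|b| <= `|h * v.2| & f p2 - f p
    = (h * v.2) * partial 1 f (p + b *: direction R 1).
  apply: mvt_dir => t th; apply: d1; rewrite -(add0r (_ *: direction R 1)) -(scale0r (direction R 0)).
  by apply: (dP _ _ _ _).1; [rewrite normr0|exact: le_lt_trans hd2].
rewrite (addrC (_ *: direction R 0)) addrA -/p2.
have -> : f (p2 + (h * v.1) *: direction R 0) - f p =
   h * (v.1 * partial 0 f (p2 + a *: direction R 0) + v.2 * partial 1 f (p + b *: direction R 1)).
  by rewrite -[LHS](subrKA (f p2)) Ea Eb; ring.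
have -> (x : R) : h^-1 *: (h * x) = x by rewrite /GRing.scale/= mulKf.
rewrite opprD addrACA -!mulrBr.
apply: (le_trans (ler_normD _ _)); rewrite !normrM.
apply: (@le_trans _ _ (`|v.1| * e + `|v.2| * e)).
  apply: lerD; apply: ler_wpM2l => //.
    rewrite /p2 -addrA (addrC (_ *: direction R 1)).
    by apply: (dP _ _ _ _).2.1; [exact: le_lt_trans hd1|].
  rewrite -(add0r (b *: direction R 1)) -(scale0r (direction R 0)).
  by apply: (dP _ _ _ _).2.2; [rewrite normr0|exact: le_lt_trans hd2].
rewrite -mulrDl /e mulrCA ler_piMr ?(ltW eps0)// ler_pdivrMr// mul1r.
by rewrite lerDl.
Unshelve. all: by end_near. Qed.

(** The mean value theorem twice: along [j] for the increment of [f] in the direction [k], then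
    along [k] for the partial derivative that appears. *)
Lemma second_difference f j k p (h d : R) : 0 < h < d ->
  (forall a b : R, `|a| < d -> `|b| < d ->
    derivable f (p + (a *: direction R j + b *: direction R k)) (direction R j) /\
    derivable (partial j f) (p + (a *: direction R j + b *: direction R k)) (direction R k)) ->
  exists a b : R, [/\ `|a| < d, `|b| < d &
    f (p + (h *: direction R j + h *: direction R k)) - f (p + h *: direction R j)
    - (f (p + h *: direction R k) - f p) =
    h * (h * partial k (partial j f) (p + (a *: direction R j + b *: direction R k)))].
Proof.
move=> /andP[h0 hd] df; set e := direction R j in df *; set e' := direction R k in df *.
pose g q := f (q + h *: e') - f q.
have small (t : R) : `|t| <= `|h| -> `|t| < d.
  by move=> th; rewrite (le_lt_trans th)// gtr0_norm.
have d0 : `|0 : R| < d by rewrite normr0 (lt_trans h0).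
have D (t : R) : `|t| <= `|h| -> is_derive t 1 (fun s => g (p + s *: e))
    (partial j f (p + t *: e + h *: e') - partial j f (p + t *: e)).
  move=> th; rewrite /g.
  have -> : (fun s : R => f (p + s *: e + h *: e') - f (p + s *: e)) =
      (fun s => f ((p + h *: e') + s *: e) - f (p + s *: e)).
    by apply/funext => s; rewrite addrAC.
  rewrite (addrAC p); apply: is_deriveB; apply: is_derive_line.
    rewrite addrAC -addrA; apply: (df _ _ _ _).1; apply: small => //.
  rewrite -(addr0 (t *: e)) -(scale0r e').
  by apply: (df _ _ _ _).1 => //; apply: small.
have H (t : R) : t \in `[0, h] -> `|t| <= `|h|.
  by rewrite in_itv/= => /andP[t0 ts]; rewrite !ger0_norm// ltW.
have cont : {within `[0, h], continuous (fun s => g (p + s *: e))}.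
  by apply: derivable_within_continuous => t /H /D[].
have [a /H ah] := MVT_segment (ltW h0) (fun t ts => D t (H t (subset_itv_oo_cc ts))) cont.
have [b bh Eb] : exists2 b : R, `|b| <= `|h| &
    partial j f (p + a *: e + h *: e') - partial j f (p + a *: e)
    = h * partial k (partial j f) (p + a *: e + b *: e').
  by apply: mvt_dir => t th; rewrite -addrA; apply: (df _ _ _ _).2; exact: small.
rewrite Eb scale0r addr0 subr0 => E; exists a, b; split; [exact: small|exact: small|].
by rewrite !(addrA p) mulrA mulrAC -E.
Qed.

Lemma dist_half (x y z e : R) : `|x - y| <= e / 2 -> `|z - y| <= e / 2 -> `|x - z| <= e.
Proof.
move=> xy zy; rewrite (splitr e) -(subrKA y) (le_trans (ler_normD _ _))//.
by rewrite lerD// distrC.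
Qed.

(** The second difference does not depend on the order of the two steps, so the two mixed
    derivatives take a common value, each at some point close to [p]; continuity moves both points
    to [p]. *)
Lemma partialC U f j k p : open U -> Ck 2 U f -> U p ->
  partial j (partial k f) p = partial k (partial j f) p.
Proof.
move=> oU Cf Up.
wlog [-> ->] : j k / j = 0 /\ k = 1.
  move=> W; have two (i : 'I_2) : i = 0 \/ i = 1.
    by case: i => [[|[|//]] i2]; [left|right]; apply/val_inj.
  case: (two j) (two k) => [->|->] [->|->];
    [exact: erefl|by apply: W; split|by apply: esym; apply: W; split|exact: erefl].
have [_ df] := Cf.
have [d0 C0] := df 0; have [d1 C1] := df 1.
have [_ d01] := C0; have [_ d10] := C1.
have [d01' [c01 _]] := d01 1; have [d10' [c10 _]] := d10 0.
apply/eqP; rewrite -subr_eq0 -normr_le0; apply/ler_addgt0Pr => e e0; rewrite add0r.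
have e20 : 0 < e / 2 by rewrite divr_gt0.
have N0 : \forall q \near p, `|partial 0 (partial 1 f) p - partial 0 (partial 1 f) q| <= e / 2.
  by have /cvgrPdist_le := c10 _ Up; apply.
have N1 : \forall q \near p, `|partial 1 (partial 0 f) p - partial 1 (partial 0 f) q| <= e / 2.
  by have /cvgrPdist_le := c01 _ Up; apply.
have NU : \forall q \near p, U q by apply: open_nbhs_nbhs.
have [d dgt0 dP] := nbhs_box (filterI NU (filterI N0 N1)).
have hd : 0 < d / 2 < d by rewrite divr_gt0//= gtr_pMr// invf_lt1// ltr1n.
have [a [b [ad bd E1]]] :=
  @second_difference f 0 1 p _ _ hd (fun a b ad bd => conj (d0 _ (dP a b ad bd).1) (d01' _ (dP a b ad bd).1)).
have dP' u w : `|u| < d -> `|w| < d -> U (p + (u *: direction R 1 + w *: direction R 0)).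
  by move=> ? ?; rewrite (addrC (u *: _)); apply: (dP _ _ _ _).1.
have [a' [b' [ad' bd' E2]]] :=
  @second_difference f 1 0 p _ _ hd (fun a b ad bd => conj (d1 _ (dP' a b ad bd)) (d10' _ (dP' a b ad bd))).
have h0 : d / 2 != 0 by rewrite gt_eqF//; case/andP: hd.
have E : partial 1 (partial 0 f) (p + (a *: direction R 0 + b *: direction R 1)) =
    partial 0 (partial 1 f) (p + (b' *: direction R 0 + a' *: direction R 1)).
  have swap (x y z t : R) : x - y - (z - t) = x - z - (y - t) by ring.
  have EE := etrans (etrans (esym E1) (swap _ _ _ _)) _.
  rewrite (addrC (b' *: _)); apply/(mulfI h0)/(mulfI h0); apply: EE.
  by rewrite -E2 (addrC (_ *: direction R 0)).
have [_ [H0 _]] := dP _ _ bd' ad'; have [_ [_ H1]] := dP _ _ ad bd.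
rewrite E in H1.
exact: dist_half H0 H1.
Qed.

End Differential.

(** * Homogeneous functions on an annulus *)

Section Annulus.
Variable R : realType.
Implicit Types (f g : R * R -> R) (p q v : R * R) (j : 'I_2) (a b s : R).

Definition sq p : R := p.1 ^+ 2 + p.2 ^+ 2.

(** The bound is on the squared radius, which is a polynomial. *)
Definition ann a : set (R * R) := [set p | a < sq p < 1].

Lemma sq_continuous p : {for p, continuous sq}.
Proof.
apply: cvgD; rewrite expr2.
  by apply: cvgM; exact: continuous_fst_at.
by apply: cvgM; exact: continuous_snd_at.
Qed.

Lemma open_sq_lt a : open [set p | sq p < a].
Proof.
have -> : [set p | sq p < a] = sq @^-1` [set x | x < a] by [].
by apply: open_comp; [move=> p _; exact: sq_continuous|exact: open_lt].
Qed.

Lemma open_sq_gt a : open [set p | a < sq p].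
Proof.
have -> : [set p | a < sq p] = sq @^-1` [set x | a < x] by [].
by apply: open_comp; [move=> p _; exact: sq_continuous|exact: open_gt].
Qed.

Lemma closed_sq_le a : closed [set p | sq p <= a].
Proof.
rewrite (_ : [set p | _] = ~` [set p | a < sq p]); first exact/open_closedC/open_sq_gt.
by apply/seteqP; split=> p /=; rewrite leNgt => /negP.
Qed.

Lemma closed_sq_ge a : closed [set p | a <= sq p].
Proof.
rewrite (_ : [set p | _] = ~` [set p | sq p < a]); first exact/open_closedC/open_sq_lt.
by apply/seteqP; split=> p /=; rewrite leNgt => /negP.
Qed.

Lemma open_disc : open (@disc R).
Proof. exact: open_sq_lt. Qed.

Lemma open_ann a : open (ann a).
Proof.
rewrite (_ : ann a = [set p | a < sq p] `&` [set p | sq p < 1]).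
  by apply: openI; [exact: open_sq_gt|exact: open_sq_lt].
by apply/seteqP; split=> p /= /andP.
Qed.

Lemma ann_disc a : ann a `<=` @disc R.
Proof. by move=> p /andP[]. Qed.

Lemma sq_ge0 p : 0 <= sq p.
Proof. by rewrite addr_ge0// sqr_ge0. Qed.

Lemma sqZ s p : sq (s *: p) = s ^+ 2 * sq p.
Proof. by rewrite /sq mulrDr -!exprMn. Qed.

Lemma norm_le_sq p : sq p <= 1 -> `|p.1| <= 1 /\ `|p.2| <= 1.
Proof.
move=> p1; have [x0 y0] := (sqr_ge0 p.1, sqr_ge0 p.2).
by split; rewrite -(@expr_le1 _ 2)// real_normK ?num_real// (le_trans _ p1)// ?lerDl ?lerDr.
Qed.

(** * Bounds by compactness *)

Lemma compact_in_disc (A : set (R * R)) : closed A -> A `<=` @closed_disc R -> compact A.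
Proof.
move=> cA AD; apply: (@subclosed_compact _ A (`[-1, 1] `*` `[-1, 1])) => //.
  by apply: compact_setX; exact: segment_compact.
move=> p /AD /norm_le_sq[]; rewrite !ler_norml => p1 p2.
by split; rewrite /= in_itv.
Qed.

Lemma compact_bound (K : set (R * R)) f : compact K ->
  (forall p, K p -> {for p, continuous f}) -> exists M, forall p, K p -> `|f p| <= M.
Proof.
move=> cK cf; have cfK : {within K, continuous f}.
  by apply: continuous_in_subspaceT => p; rewrite inE; exact: cf.
have [M _ HM] := pinfty_ex_gt (num_real 0) (compact_bounded (continuous_compact cfK cK)).
by exists M => p Kp; apply: HM; exists p.
Qed.

Lemma disc_bound f b M : b < 1 -> (forall p, disc p -> {for p, continuous f}) ->
  (forall p, ann b p -> `|f p| <= M) -> exists M, forall p, disc p -> `|f p| <= M.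
Proof.
move=> b1 cf fM.
have cK : compact [set p | sq p <= b].
  apply: compact_in_disc; first exact: closed_sq_le.
  by move=> p /= /le_trans; apply; exact: ltW.
have cfK p : sq p <= b -> {for p, continuous f} by move=> pb; apply: cf; exact: le_lt_trans b1.
have [M' HM'] := compact_bound cK cfK.
exists (Num.max M M') => p p1; rewrite le_max.
by case: (leP (sq p) b) => pb; [rewrite HM' ?orbT|rewrite fM// /ann/= pb].
Qed.

Definition homog a (w : R -> R) f := forall s p, 0 < s -> ann a p -> ann a (s *: p) ->
  f (s *: p) = w s * f p.

Lemma homog_sub a b w f : a <= b -> homog a w f -> homog b w f.
Proof.
move=> ab hf s p s0 /andP[bp p1] /andP[bsp sp1].
by apply: hf => //; apply/andP; split=> //; exact: le_lt_trans ab _.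
Qed.

Lemma homogD a w f g : homog a w f -> homog a w g -> homog a w (fun q => f q + g q).
Proof. by move=> hf hg s p s0 p1 p2; rewrite (hf _ _ s0 p1 p2) (hg _ _ s0 p1 p2) mulrDr. Qed.

Lemma homogM a w w' f g : homog a w f -> homog a w' g -> homog a (fun s => w s * w' s) (fun q => f q * g q).
Proof. by move=> hf hg s p s0 p1 p2; rewrite (hf _ _ s0 p1 p2) (hg _ _ s0 p1 p2) mulrACA. Qed.

Lemma homogN a w f : homog a w f -> homog a w (fun q => - f q).
Proof. by move=> hf s p s0 p1 p2; rewrite (hf _ _ s0 p1 p2) mulrN. Qed.

Lemma homog_ext a w w' f g : (forall s, 0 < s -> w s = w' s) ->
  (forall p, ann a p -> f p = g p) -> homog a w f -> homog a w' g.
Proof. by move=> ww fg hf s p s0 p1 p2; rewrite -ww// -!fg//; exact: hf. Qed.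

Lemma homog_fst a : homog a id (fun q => q.1).
Proof. by []. Qed.

Lemma homog_snd a : homog a id (fun q => q.2).
Proof. by []. Qed.

(** Both sides of f(s q) = w(s) f(q) are differentiated in q; the chain rule brings out a factor s
    on the left. *)
Lemma homog_partial a w f j : Cinfty (ann a) f -> homog a w f ->
  homog a (fun s => w s / s) (partial j f).
Proof.
move=> Cf hf s p s0 ap asp.
have D : is_derive p (direction R j) (fun q => f (s *: q)) (s * partial j f (s *: p)).
  have := C1_is_derive (s *: direction R j) (@open_ann a) (Cf 1%N) asp.
  have -> : (s *: direction R j).1 * partial 0 f (s *: p) +
     (s *: direction R j).2 * partial 1 f (s *: p) = s * partial j f (s *: p).
    case: j => [[|[|//]] j2]; rewrite /direction/= /GRing.scale/= mulr1 mulr0 mul0r ?addr0 ?add0r.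
      by congr (_ * partial _ _ _); apply/val_inj.
    by congr (_ * partial _ _ _); apply/val_inj.
  have E : (fun h : R => h^-1 *: (((fun q => f (s *: q)) \o shift p) (h *: direction R j) - f (s *: p)))
       = (fun h : R => h^-1 *: ((f \o shift (s *: p)) (h *: (s *: direction R j)) - f (s *: p))).
    apply/funext => h /=; congr (_ *: (f _ - _)).
    by rewrite scalerDr !scalerA mulrC.
  move=> [d1 d2]; apply: DeriveDef; first by rewrite /derivable E.
  by rewrite /derive E.
have D' : is_derive p (direction R j) (fun q => f (s *: q)) (w s * partial j f p).
  apply: (@near_eq_is_derive _ _ _ (fun q => w s * f q)).
    have : nbhs p (ann a `&` (fun q => s *: q) @^-1` (ann a)).
      apply: filterI; first exact: open_nbhs_nbhs (conj (@open_ann a) ap).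
      have cs : {for p, continuous (fun q : R * R => s *: q)} by exact: scaler_continuous.
      by apply: cs; exact: open_nbhs_nbhs (conj (@open_ann a) asp).
    by apply: filterS => q [aq asq]; rewrite hf.
  have df : derivable f p (direction R j) by exact: Cinfty_derivable Cf ap.
  exact: (is_deriveZ (w s) (derivableP df)).
have := (@derive_val _ _ _ _ _ _ _ D); rewrite (@derive_val _ _ _ _ _ _ _ D') => E.
by rewrite mulrAC E mulrAC divff ?mul1r// gt_eqF.
Qed.

Lemma is_derive_aff n : is_derive (0 : R) 1 (fun h : R => (1 + h) ^+ n) n%:R.
Proof.
rewrite [X in is_derive _ _ X](_ : _ = (cst 1 + id) ^+ n); last by rewrite exprfctE.
by apply: is_derive_eq; rewrite [X in (_ * X ^+ _)]addr0 expr1n add0r /GRing.scale/= !mulr1.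
Qed.

(** The function (1 + h)^n f((1 + h) p) is constant near h = 0, and the relation is its derivative
    at 0. With the weight on this side no inverse power is differentiated. *)
Lemma euler a n f p : Cinfty (ann a) f -> homog a (fun s => s ^- n) f -> ann a p ->
  p.1 * partial 0 f p + p.2 * partial 1 f p = - n%:R * f p.
Proof.
move=> Cf hf ap.
have df := C1_is_derive p (@open_ann a) (Cf 1%N) ap.
set E := _ + _ in df *.
have p0 : p + 0 *: p = p by rewrite scale0r addr0.
have D1 : is_derive (0 : R) 1 (fun h : R => f (p + h *: p)) E.
  have := @is_derive_line _ f p p 0; rewrite p0 (@derive_val _ _ _ _ _ _ _ df).
  by apply; case: df.
have D2 := is_derive_aff n.
have D3 := is_deriveM D2 D1.
have D4 : is_derive (0 : R) 1 ((fun h : R => (1 + h) ^+ n) * (fun h : R => f (p + h *: p))) 0.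
  apply: (@near_eq_is_derive _ _ _ (cst (f p))).
    have : nbhs (0 : R) ((fun h : R => p + h *: p) @^-1` (ann a) `&` [set h | -1 < h]).
      apply: filterI; last by apply: open_nbhs_nbhs; split; [exact: open_gt|rewrite /= oppr_lt0].
      have cs : {for (0:R), continuous (fun h : R => p + h *: p)}.
        by apply: cvgD; [exact: cvg_cst|exact: scalel_continuous].
      by apply: cs; apply: open_nbhs_nbhs; split; [exact: open_ann|rewrite p0].
    apply: filterS => h [aph h1] /=.
    have h0 : 0 < 1 + h by rewrite -ltrBlDl sub0r.
    rewrite [RHS]/(_ * _) /= -[X in f (X + _)]scale1r -scalerDl hf//; last by rewrite scalerDl scale1r.
    transitivity ((1 + h) ^+ n * ((1 + h) ^- n * f p)); last by [].
    by rewrite mulrA mulfV ?mul1r// expf_neq0// gt_eqF.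
have := (@derive_val _ _ _ _ _ _ _ D3); rewrite (@derive_val _ _ _ _ _ _ _ D4).
rewrite p0 addr0 expr1n scale1r /GRing.scale/= => H.
by apply/eqP; rewrite mulNr -addr_eq0 mulrC eq_sym; apply/eqP.
Qed.

(* Scaling by [s = shr a] sends [s < sq p < 1] into a compact part of [ann a],
   because [a < s ^+ 3]. *)
Definition shr a : R := 1 - (1 - a) / 4.

(** With t = (1 - a) / 4 one has a = 1 - 4t, while (1 - t)^3 >= 1 - 3t. *)
Lemma shr_bounds a : 0 <= a < 1 -> [/\ 0 < shr a, a < shr a, shr a < 1 & a < shr a ^+ 3].
Proof.
move=> /andP[a0 a1]; rewrite /shr; set t := (1 - a) / 4.
have at4 : a = 1 - 4 * t by rewrite /t; field.
have t0 : 0 < t by rewrite divr_gt0// subr_gt0.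
have t4 : t <= 1/4 by rewrite /t ler_pM2r ?invr_gt0//; lra.
by split; rewrite ?at4; nra.
Qed.

(** A value near the circle is the value at [s *: p] divided by w(s), and [s *: p] stays in a
    compact set on which f is continuous. *)
Lemma homog_bounded a w f : 0 <= a < 1 -> (forall s, 0 < s -> w s != 0) ->
  (forall p, ann a p -> {for p, continuous f}) ->
  homog a w f -> exists M, forall p, ann (shr a) p -> `|f p| <= M.
Proof.
move=> a01 w0 cf hf; have [s0 as1 s1 as3] := shr_bounds a01; set s := shr a in s0 as1 s1 as3 *.
have s21 : s ^+ 2 < 1 by rewrite expr_lt1// ltW.
pose K := [set p | s ^+ 3 <= sq p] `&` [set p | sq p <= s ^+ 2].
have KA : K `<=` ann a.
  by move=> p [/= p1 p2]; rewrite /ann/= (lt_le_trans as3)//= (le_lt_trans p2).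
have cK : compact K.
  apply: compact_in_disc; first by apply: closedI; [exact: closed_sq_ge|exact: closed_sq_le].
  by move=> p [_ /= /le_trans]; apply; exact: ltW.
have [M HM] := compact_bound cK (fun p Kp => cf p (KA p Kp)).
exists (`|w s|^-1 * M) => p /andP[p1 p2].
have Ksp : K (s *: p).
  have ss : 0 < s ^+ 2 by rewrite exprn_gt0.
  by split; rewrite /= sqZ; [rewrite exprS mulrC ler_pM2l// ltW|rewrite ler_piMr// ltW].
have := HM _ Ksp; rewrite hf//; last exact: KA.
  by rewrite normrM mulrC -ler_pdivlMr ?normr_gt0 ?w0// mulrC.
by rewrite /ann/= p2 andbT (lt_trans as1).
Qed.

End Annulus.

(** * The radial condition as homogeneity *)

Section Radial.
Variable R : realType.
Implicit Types (V W : vfield R) (p q : R * R) (j i : 'I_2) (a b s r t : R).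

(** The coordinates of V in the frame e, t. In terms of the polar ones, [radc] is V3 / r and [angc]
    is V4. *)
Definition radc V p : R := (p.1 * vcomp V 0 p + p.2 * vcomp V 1 p) / sq p.

Definition angc V p : R := (p.1 * vcomp V 1 p - p.2 * vcomp V 0 p) / sq p.

(** Degree 0 is written [s ^- 0] so that the lemmas on weights [s ^- n] cover both coordinates. *)
Definition radial a V := homog a (fun s => s ^- 1) (radc V) /\ homog a (fun s => s ^- 0) (angc V).

Definition smooth V := forall i, Cinfty (@disc R) (vcomp V i).

Lemma radial_sub a b V : a <= b -> radial a V -> radial b V.
Proof. by move=> ab [h1 h2]; split; exact: homog_sub ab _. Qed.

Lemma vfieldE0 V p : sq p != 0 -> vcomp V 0 p = p.1 * radc V p - p.2 * angc V p.
Proof. by rewrite /radc /angc /sq => p0; field. Qed.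

Lemma vfieldE1 V p : sq p != 0 -> vcomp V 1 p = p.2 * radc V p + p.1 * angc V p.
Proof. by rewrite /radc /angc /sq => p0; field. Qed.

Lemma ann_neq0 a p : 0 <= a -> ann a p -> sq p != 0.
Proof. by move=> a0 /andP[ap _]; rewrite gt_eqF// (le_lt_trans a0). Qed.

Lemma Cinfty_sq (U : set (R * R)) : open U -> Cinfty U (@sq R).
Proof.
move=> oU; apply: (@CinftyD _ _ (fun p => p.1 ^+ 2) (fun p => p.2 ^+ 2)) => //.
  exact: (CinftyM oU (Cinfty_fst oU) (Cinfty_fst oU)).
exact: (CinftyM oU (Cinfty_snd oU) (Cinfty_snd oU)).
Qed.

Lemma Cinfty_rad a V : 0 <= a -> smooth V -> Cinfty (ann a) (radc V).
Proof.
move=> a0 sV; have oA := @open_ann R a.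
have S i : Cinfty (ann a) (vcomp V i) := Cinfty_sub (@ann_disc R a) (sV i).
apply: (CinftyM oA); last by apply: CinftyV => //; [move=> p; exact: ann_neq0|exact: Cinfty_sq].
exact: (CinftyD oA (CinftyM oA (Cinfty_fst oA) (S 0)) (CinftyM oA (Cinfty_snd oA) (S 1))).
Qed.

Lemma Cinfty_ang a V : 0 <= a -> smooth V -> Cinfty (ann a) (angc V).
Proof.
move=> a0 sV; have oA := @open_ann R a.
have S i : Cinfty (ann a) (vcomp V i) := Cinfty_sub (@ann_disc R a) (sV i).
apply: (CinftyM oA); last by apply: CinftyV => //; [move=> p; exact: ann_neq0|exact: Cinfty_sq].
exact: (CinftyB oA (CinftyM oA (Cinfty_fst oA) (S 1)) (CinftyM oA (Cinfty_snd oA) (S 0))).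
Qed.

Lemma sq_polar r t : sq (polar r t) = r ^+ 2.
Proof. by rewrite /sq /polar/= !exprMn -mulrDr cos2Dsin2 mulr1. Qed.

Lemma polar_scale s r t : s *: polar r t = polar (s * r) t.
Proof. by rewrite /polar; congr (_, _) => /=; rewrite /GRing.scale/= mulrA. Qed.

Lemma polar_exists p : sq p != 0 -> exists r t, 0 < r /\ p = polar r t.
Proof.
move=> p0; set r := Num.sqrt (sq p).
have r2 : r ^+ 2 = sq p by rewrite sqr_sqrtr// sq_ge0.
have r0 : r != 0 by rewrite -sqrf_eq0 r2.
set x := p.1 / r; set y := p.2 / r.
have xy : x ^+ 2 + y ^+ 2 = 1.
  by rewrite /x /y !exprMn -mulrDl exprVn r2 -/(sq p) divff.
have y2 : 1 - x ^+ 2 = y ^+ 2 by rewrite -xy addrAC subrr add0r.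
have x1 : -1 <= x <= 1.
  have xx : `|x| <= 1 by rewrite -(@expr_le1 _ 2)// real_normK ?num_real// -xy lerDl sqr_ge0.
  by rewrite ler_norml in xx.
(* [acos] reaches the upper half circle only; the sign of y decides between [acos x] and its
   opposite. *)
have [t tx ty] : exists2 t, cos t = x & sin t = y.
  have [y0|y0] := leP 0 y.
    by exists (acos x); rewrite ?acosK ?in_itv//= sin_acos// y2 sqrtr_sqr ger0_norm.
  exists (- acos x); first by rewrite cosN acosK ?in_itv.
  by rewrite sinN sin_acos// y2 sqrtr_sqr ltr0_norm// opprK.
exists r, t; split; first by rewrite lt_neqAle eq_sym r0 sqrtr_ge0.
by rewrite /polar tx ty /x /y ![r * _]mulrC !divfK//; exact: surjective_pairing.
Qed.

Lemma polar_form_rad V F G r t : polar_form V F G -> 0 < r < 1 ->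
  radc V (polar r t) = r^-1 * F r t /\ angc V (polar r t) = G r t.
Proof.
move=> VP r01; have r0 : r != 0 by case/andP: r01 => /gt_eqF ->.
have cs : cos t ^+ 2 = 1 - sin t ^+ 2 :> R by rewrite -(cos2Dsin2 t) addrK.
rewrite /radc /angc sq_polar /vcomp VP// !mxE /= /polar/=.
by split; field: cs.
Qed.

Lemma derive0_cst (h : R -> R) a b : (forall c, Num.min a b <= c <= Num.max a b -> is_derive c 1 h 0) ->
  h a = h b.
Proof.
wlog ab : a b / a <= b.
  move=> W; have /orP[ab|ba H] := le_total a b; first exact: W.
  by symmetry; apply: (W _ _ ba) => c; rewrite minC maxC; exact: H.
rewrite (min_idPl ab) (max_idPr ab) => H.
have D c : c \in `]a, b[ -> is_derive c 1 h ((fun=> 0) c).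
  by rewrite in_itv/= => /andP[/ltW ac /ltW cb]; apply: H; rewrite ac.
have C : {within `[a, b], continuous h}.
  by apply: derivable_within_continuous => c; rewrite in_itv/= => /H[].
have [c _] := MVT_segment ab D C.
by rewrite mul0r => /eqP; rewrite subr_eq0 => /eqP.
Qed.

(** The part of the closed disc outside the interior of [N] is compact and misses the circle, so 1 /
    (1 - |p|^2) is bounded on it, say by M. The annulus of squared inner radius 1 - 1 / max(M, 1)
    avoids that part; the maximum with 1 keeps this radius nonnegative. *)
Lemma circle_nbhs (N : set (R * R)) : set_nbhs (@circle R) N ->
  exists2 a, 0 <= a < 1 & ann a `<=` N.
Proof.
move=> HN; pose K := @closed_disc R `&` ~` N°.
have cK : compact K.
  apply: compact_in_disc; last by move=> p [].
  apply: closedI; first exact: closed_sq_le.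
  by apply: open_closedC; exact: open_interior.
have K1 p : K p -> 1 - sq p != 0.
  move=> [_ pN]; apply/eqP => /subr0_eq p1; apply: pN; apply: HN.
  by rewrite /circle/= -/(sq p) -p1.
have cf p : K p -> {for p, continuous (fun q => (1 - sq q)^-1)}.
  move=> Kp; apply: cvgV; first exact: K1.
  by apply: cvgB; [exact: cvg_cst|exact: sq_continuous].
have [M HM] := compact_bound cK cf.
pose m := Num.max M 1.
have m1 : 1 <= m by rewrite le_max lexx orbT.
have m0 : 0 < m by exact: lt_le_trans m1.
exists (1 - m^-1); first by rewrite subr_ge0 invf_le1// m1/= gtrBl invr_gt0.
move=> p /andP[ap p1]; apply: interior_subset; apply: contrapT => pN.
have Kp : K p by split=> //; rewrite /closed_disc/= -/(sq p) ltW.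
have := HM _ Kp; have d0 : 0 < 1 - sq p by rewrite subr_gt0.
rewrite gtr0_norm ?invr_gt0// => HMp.
have : (1 - sq p)^-1 <= m by rewrite le_max HMp.
rewrite -lef_pV2 ?posrE ?invr_gt0// invrK.
by rewrite leNgt => /negP; apply; rewrite ltrBlDr -ltrBlDl.
Qed.

Lemma GVect_radial V : radially_constant_near_circle V -> exists2 a, 0 <= a < 1 & radial a V.
Proof.
move=> [F [G [VP [N /circle_nbhs[a a01 aN] HN]]]]; exists a => //.
have [a0 a1] := andP a01.
have lt1 (x : R) : 0 < x -> x ^+ 2 < 1 -> 0 < x < 1.
  by move=> x0; rewrite expr_lt1// ?x0// ltW.
have sqle (x y : R) : 0 < x -> x <= y -> x ^+ 2 <= y ^+ 2.
  by move=> x0 xy; rewrite ler_pXn2r// ?nnegrE ltW// (lt_le_trans x0).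
(* At a fixed angle the segment between two radii of the annulus stays in the annulus, so V3 and V4
   are constant along it. *)
have cstF (r r' t : R) : 0 < r -> 0 < r' -> a < r ^+ 2 < 1 -> a < r' ^+ 2 < 1 ->
    F r t = F r' t /\ G r t = G r' t.
  move=> r0 r'0 /andP[ar r1] /andP[ar' r'1].
  have D c : Num.min r r' <= c <= Num.max r r' ->
      is_derive c 1 (F ^~ t) 0 /\ is_derive c 1 (G ^~ t) 0.
    rewrite ge_min le_max => /andP[cr cr'].
    have c0 : 0 < c by case/orP: cr; exact: lt_le_trans.
    have ac : a < c ^+ 2.
      by case/orP: cr => h; [apply: lt_le_trans ar _|apply: lt_le_trans ar' _]; exact: sqle.
    have c1 : c ^+ 2 < 1.
      by case/orP: cr' => h; [apply: le_lt_trans r1|apply: le_lt_trans r'1]; exact: sqle.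
    apply: HN; first exact: lt1.
    by apply: aN; rewrite /ann/= sq_polar ac.
  by split; [apply: (@derive0_cst (F ^~ t)) => c /D[]|apply: (@derive0_cst (G ^~ t)) => c /D[]].
have key s p : 0 < s -> ann a p -> ann a (s *: p) ->
    radc V (s *: p) = s^-1 * radc V p /\ angc V (s *: p) = angc V p.
  move=> s0 ap; have p0 := ann_neq0 a0 ap; have [r [t [r0 Ep]]] := polar_exists p0.
  move: ap; rewrite Ep polar_scale /ann/= !sq_polar => ar asr.
  have sr0 : 0 < s * r by rewrite mulr_gt0.
  have r1 := lt1 _ r0 (andP ar).2; have sr1 := lt1 _ sr0 (andP asr).2.
  have [-> ->] := polar_form_rad t VP r1.
  have [-> ->] := polar_form_rad t VP sr1.
  have [-> ->] := cstF _ _ t r0 sr0 ar asr.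
  by rewrite invfM mulrA.
split=> s p s0 ap asp; have [E1 E2] := key s p s0 ap asp; first exact: E1.
by rewrite E2 expr0 invr1 mul1r.
Qed.

Lemma radial_GVect a V : 0 <= a < 1 -> radial a V -> radially_constant_near_circle V.
Proof.
move=> /andP[a0 a1] [hr ha].
(* Since e is r d/dr, the polar coefficients of f e + g t are V3 = r f and V4 = g. *)
exists (fun r t => r * radc V (polar r t)), (fun r t => angc V (polar r t)); split.
  move=> r t /andP[r0 r1]; apply/rowP => i; rewrite !mxE.
  have p0 : sq (polar r t) != 0 by rewrite sq_polar sqrf_eq0 gt_eqF.
  have [E0 E1] := (vfieldE0 V p0, vfieldE1 V p0).
  case: (boolP (i == 0)) => i0.
    by rewrite (eqP i0) -[LHS]/(vcomp V 0 (polar r t)) E0 /polar/=; ring.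
  have -> : i = 1 by case: (i) i0 => [[|[|//]] i2] // _; exact: val_inj.
  by rewrite -[LHS]/(vcomp V 1 (polar r t)) E1 /polar/=; ring.
exists [set p | a < sq p].
  move=> p; rewrite /circle/= -/(sq p) => p1.
  by apply: open_nbhs_nbhs; split; [exact: open_sq_gt|rewrite /= p1].
move=> r t /andP[r0 r1]; rewrite /= sq_polar => ar.
have cX : {for r, continuous (fun x : R => x ^+ 2)} by exact: exprn_continuous.
have near1 : \forall x \near r, [/\ 0 < x, x < 1 & a < x ^+ 2].
  near=> x; split.
  - by near: x; apply: open_nbhs_nbhs; split; [exact: open_gt|].
  - by near: x; apply: open_nbhs_nbhs; split; [exact: open_lt|].
  - by near: x; apply: (cX [set y | a < y]); apply: open_nbhs_nbhs; split; [exact: open_gt|].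
have lt1 (x : R) : 0 < x -> x < 1 -> x ^+ 2 < 1 by move=> x0 x1; rewrite expr_lt1// ltW.
have E x : [/\ 0 < x, x < 1 & a < x ^+ 2] ->
    radc V (polar x t) = (x / r)^-1 * radc V (polar r t) /\ angc V (polar x t) = angc V (polar r t).
  move=> [x0 x1 ax]; have xr0 : 0 < x / r by rewrite divr_gt0.
  have Ex : polar x t = (x / r) *: polar r t by rewrite polar_scale divfK// gt_eqF.
  have ap : ann a (polar r t) by rewrite /ann/= sq_polar ar lt1.
  have apx : ann a ((x / r) *: polar r t) by rewrite -Ex /ann/= sq_polar ax lt1.
  split; rewrite Ex; first exact: hr.
  by rewrite ha// expr0 invr1 mul1r.
split.
- apply: (@near_eq_is_derive _ _ _ (cst (r * radc V (polar r t)))).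
    apply: filterS near1 => x Hx; rewrite (E x Hx).1; case: Hx => x0 _ _ /=.
    by rewrite invfM invrK (mulrC _ r) !mulrA (mulrC x) mulfK// gt_eqF.
- apply: (@near_eq_is_derive _ _ _ (cst (angc V (polar r t)))).
  by apply: filterS near1 => x Hx; rewrite (E x Hx).2.
Unshelve. all: by end_near. Qed.

End Radial.

(** * The Lie algebra *)

(** Meant for functions glued from pieces: near [p] and inside [A], [g] coincides with a function
    that is continuous at [p]. *)
Lemma continuous_within_eq (T U : topologicalType) (A O : set T) (f g : T -> U) (p : T) :
  open O -> O p -> A p -> (forall q, O q -> A q -> g q = f q) -> {for p, continuous f} ->
  g @ within A (nbhs p) --> g p.
Proof.
move=> oO Op Ap gf cf; rewrite (gf _ Op Ap).
have H : f @ within A (nbhs p) --> f p by apply: cvg_within_filter; exact: cf.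
apply: cvg_trans H; apply: near_eq_cvg; rewrite /prop_near1 /within/=.
have : nbhs p O by exact: open_nbhs_nbhs.
by apply: filterS => q Oq Aq; rewrite gf.
Qed.

Lemma continuous_vec2 (R : realType) (f g : R * R -> R) (p : R * R) :
  {for p, continuous f} -> {for p, continuous g} ->
  {for p, continuous (fun q => vec2 (f q) (g q))}.
Proof.
move=> cf cg; rewrite (_ : (fun q => vec2 (f q) (g q)) = (fun q => f q *: vec2 1 0 + g q *: vec2 0 1)); last first.
  by apply/funext => q; apply/rowP => i; rewrite !mxE; case: ifP => _; ring.
by apply: cvgD; apply: cvgZr_tmp.
Qed.

Section Subalgebra.
Variable R : realType.
Implicit Types (V W : vfield R) (f g : R * R -> R) (p q : R * R) (i j k : 'I_2) (a b s : R).

Lemma vfield_vec2 V p : V p = vec2 (vcomp V 0 p) (vcomp V 1 p).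
Proof.
apply/rowP => i; rewrite mxE; case: (boolP (i == 0)) => [/eqP->//|i0].
by have -> : i = 1 by case: (i) i0 => [[|[|//]] i2] // _; exact: val_inj.
Qed.

Lemma smooth_continuous V p : smooth V -> disc p -> {for p, continuous (V : R * R -> 'rV[R]_2)}.
Proof.
move=> sV p1.
rewrite (_ : V = fun q => vec2 (vcomp V 0 q) (vcomp V 1 q)).
  by apply: continuous_vec2; exact: Cinfty_continuous (sV _) p1.
by apply/funext => q; exact: vfield_vec2.
Qed.

Lemma radialE a V s p : radial a V -> 0 < s -> ann a p -> ann a (s *: p) ->
  radc V (s *: p) = s^-1 * radc V p /\ angc V (s *: p) = angc V p.
Proof.
move=> [hr ha] s0 ap asp; have [E1 E2] := (hr _ _ s0 ap asp, ha _ _ s0 ap asp).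
by split; [exact: E1|rewrite E2 expr0 invr1 mul1r].
Qed.

(** Near the circle f(p) = s f(s p) and g(p) = g(s p). The right-hand sides remain defined and
    continuous on the circle, where [s *: p] is still inside the disc; [G] is the field they
    give. *)
Lemma smooth_extends a V : 0 <= a < 1 -> smooth V -> radial a V ->
  exists Vbar : vfield R, {within @closed_disc R, continuous Vbar} /\
    (forall p, disc p -> Vbar p = V p).
Proof.
move=> a01 sV rV; have [a0 a1] := andP a01.
have [s0 as1 s1 as3] := shr_bounds a01; set s := shr a in s0 as1 s1 as3 *.
pose G p := vec2 (p.1 * (s * radc V (s *: p)) - p.2 * angc V (s *: p))
                 (p.2 * (s * radc V (s *: p)) + p.1 * angc V (s *: p)).
have ss : s ^+ 3 <= s ^+ 2 by rewrite exprS ler_piMl ?exprn_ge0// ltW.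
have s21 : s ^+ 2 < 1 by rewrite expr_lt1// ltW.
have annZ p : s < sq p -> sq p <= 1 -> ann a (s *: p).
  move=> sp p1; rewrite /ann/= sqZ; apply/andP; split.
    by rewrite (lt_trans as3)// exprSr ltr_pM2l// exprn_gt0.
  by rewrite (le_lt_trans _ s21)// ler_piMr// exprn_ge0// ltW.
exists (fun p => if sq p < 1 then V p else G p); split; last first.
  by move=> p p1; rewrite [sq p < 1]p1.
have VG p : s < sq p < 1 -> V p = G p.
  move=> /andP[sp p1]; have ap : ann a p by rewrite /ann/= (lt_trans as1).
  have asp := annZ p sp (ltW p1).
  rewrite [LHS]vfield_vec2 (vfieldE0 V (ann_neq0 a0 ap)) (vfieldE1 V (ann_neq0 a0 ap)).
  have [E1 E2] := radialE rV s0 ap asp.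
  by rewrite /G E1 E2 mulVKf// gt_eqF.
apply/subspace_continuousP => p; rewrite /closed_disc/= -/(sq p) => p1.
have [pl|pl] := boolP (sq p < 1).
  apply: (@continuous_within_eq _ _ _ [set q | sq q < 1] V) => //.
  - exact: open_sq_lt.
  - by move=> q q1 _; exact: (ifT _ _ q1).
  - exact: smooth_continuous.
have pe : sq p = 1 by apply/eqP; rewrite eq_le p1 leNgt.
have asp : ann a (s *: p) by apply: annZ; rewrite pe.
have cs : {for p, continuous (fun q : R * R => s *: q)} by exact: scaler_continuous.
have cG : {for p, continuous G}.
  have cr : radc V (s *: q) @[q --> p] --> radc V (s *: p).
    exact: (continuous_comp cs (Cinfty_continuous (Cinfty_rad a0 sV) asp)).
  have ca : angc V (s *: q) @[q --> p] --> angc V (s *: p).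
    exact: (continuous_comp cs (Cinfty_continuous (Cinfty_ang a0 sV) asp)).
  apply: continuous_vec2; [apply: cvgB|apply: cvgD].
  - by apply: cvgM; [exact: continuous_fst_at|apply: cvgM => //; exact: cvg_cst].
  - by apply: cvgM => //; exact: continuous_snd_at.
  - by apply: cvgM; [exact: continuous_snd_at|apply: cvgM => //; exact: cvg_cst].
  - by apply: cvgM => //; exact: continuous_fst_at.
apply: (@continuous_within_eq _ _ _ [set q | s < sq q] G) => //.
- exact: open_sq_gt.
- by rewrite /= pe.
- move=> q /= sq1 _; have [q1|q1] := boolP (sq q < 1).
    by apply: etrans (ifT _ _ q1) _; apply: VG; rewrite sq1.
  exact: (ifN _ _ q1).
Qed.

(** The working form of membership. Each field brings its own annulus, and operations on several
    fields restrict to the thinnest one. *)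
Lemma GVect_arP V : GVect_ar V <->
  [/\ forall p, ~ disc p -> V p = 0, smooth V & exists2 a, 0 <= a < 1 & radial a V].
Proof.
split=> [[V0 sV _ rV]|[V0 sV [a a01 rV]]]; first by split=> //; exact: GVect_radial.
split=> //; first exact: smooth_extends rV.
exact: radial_GVect rV.
Qed.

Lemma vcompD c V W i p : vcomp (c *: (V : R * R -> 'rV[R]_2) + W) i p = c * vcomp V i p + vcomp W i p.
Proof. by transitivity ((c *: V p + W p) 0 i); [exact: erefl|rewrite !mxE]. Qed.

Lemma bracketE V W i p : vcomp (bracket V W) i p =
  (vcomp V 0 p * partial 0 (vcomp W i) p - vcomp W 0 p * partial 0 (vcomp V i) p)
  + (vcomp V 1 p * partial 1 (vcomp W i) p - vcomp W 1 p * partial 1 (vcomp V i) p).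
Proof.
rewrite {1}/vcomp mxE big_ord_recl big_ord1.
by have -> : lift ord0 ord0 = 1 :> 'I_2 by exact: val_inj.
Qed.

Lemma GVect_lin c V W : GVect_ar V -> GVect_ar W ->
  GVect_ar (c *: (V : R * R -> 'rV[R]_2) + W).
Proof.
move=> /GVect_arP[oV sV [a /andP[a0 a1] [rV aV]]] /GVect_arP[oW sW [b /andP[b0 b1] [rW aW]]].
apply/GVect_arP; split.
- by move=> p pN; rewrite -[LHS]/(c *: V p + W p) oV// oW// scaler0 addr0.
- move=> i; have oD := @open_disc R.
  apply: (Cinfty_ext oD _ (CinftyD oD (CinftyM oD (Cinfty_cst c oD) (sV i)) (sW i))) => p _.
  by rewrite vcompD.
- exists (Num.max a b); first by rewrite le_max a0 gt_max a1.
  have la : a <= Num.max a b by rewrite le_max lexx.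
  have lb : b <= Num.max a b by rewrite le_max lexx orbT.
  split=> s p s0 p1 p2.
    have E q : radc (c *: (V : R * R -> 'rV[R]_2) + W) q = c * radc V q + radc W q.
      by rewrite /radc !vcompD mulrA -mulrDl; congr (_ / _); ring.
    by rewrite !E (homog_sub la rV)// (homog_sub lb rW)//; ring.
  have E q : angc (c *: (V : R * R -> 'rV[R]_2) + W) q = c * angc V q + angc W q.
    by rewrite /angc !vcompD mulrA -mulrDl; congr (_ / _); ring.
  by rewrite !E (homog_sub la aV)// (homog_sub lb aW)//; ring.
Qed.

Lemma GVect0 : GVect_ar (0 : R * R -> 'rV[R]_2).
Proof.
have E i p : vcomp (0 : R * R -> 'rV[R]_2) i p = 0.
  by transitivity ((0 : 'rV[R]_2) 0 i); [exact: erefl|rewrite mxE].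
apply/GVect_arP; split=> // [i|].
  apply: (Cinfty_ext (@open_disc R) _ (Cinfty_cst 0 (@open_disc R))) => p _.
  by rewrite E.
exists 0; first by rewrite lexx ltr01.
by split=> s p s0 p1 p2; rewrite /radc /angc !E !mulr0 ?subr0 ?addr0 !mul0r mulr0.
Qed.

Lemma smooth_bracket V W : smooth V -> smooth W -> smooth (bracket V W).
Proof.
move=> sV sW i; have oD := @open_disc R.
have H j := CinftyB oD (CinftyM oD (sV j) (Cinfty_partial j (sW i)))
                       (CinftyM oD (sW j) (Cinfty_partial j (sV i))).
apply: (Cinfty_ext oD _ (CinftyD oD (H 0) (H 1))) => p _.
by rewrite bracketE.
Qed.

(** * Jacobian and bracket in the frame e, t *)

Lemma partial_fstM U f j p : open U -> Cinfty U f -> U p ->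
  partial j (fun q => q.1 * f q) p = (j == 0)%:R * f p + p.1 * partial j f p.
Proof.
move=> oU Cf Up; rewrite partialM; first by rewrite partial_fst addrC (mulrC (f p)).
  exact: derivable_fst.
exact: Cinfty_derivable Cf Up.
Qed.

Lemma partial_sndM U f j p : open U -> Cinfty U f -> U p ->
  partial j (fun q => q.2 * f q) p = (j != 0)%:R * f p + p.2 * partial j f p.
Proof.
move=> oU Cf Up; rewrite partialM; first by rewrite partial_snd addrC (mulrC (f p)).
  exact: derivable_snd.
exact: Cinfty_derivable Cf Up.
Qed.

Lemma partialB f g j p : derivable f p (direction R j) -> derivable g p (direction R j) ->
  partial j (fun q => f q - g q) p = partial j f p - partial j g p.
Proof. by move=> df dg; have := deriveB df dg. Qed.

Lemma partial_vcomp0 a V j p : 0 <= a -> smooth V -> ann a p ->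
  partial j (vcomp V 0) p = (j == 0)%:R * radc V p + p.1 * partial j (radc V) p
     - ((j != 0)%:R * angc V p + p.2 * partial j (angc V) p).
Proof.
move=> a0 sV ap; have oA := @open_ann R a.
have Cr := Cinfty_rad a0 sV; have Ca := Cinfty_ang a0 sV.
have E q : ann a q -> vcomp V 0 q = q.1 * radc V q - q.2 * angc V q.
  by move=> aq; exact: vfieldE0 (ann_neq0 a0 aq).
rewrite (partial_ext j oA ap E) partialB; first by rewrite (partial_fstM j oA Cr ap) (partial_sndM j oA Ca ap).
  exact: Cinfty_derivable (CinftyM oA (Cinfty_fst oA) Cr) ap.
exact: Cinfty_derivable (CinftyM oA (Cinfty_snd oA) Ca) ap.
Qed.

Lemma partial_vcomp1 a V j p : 0 <= a -> smooth V -> ann a p ->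
  partial j (vcomp V 1) p = (j != 0)%:R * radc V p + p.2 * partial j (radc V) p
     + ((j == 0)%:R * angc V p + p.1 * partial j (angc V) p).
Proof.
move=> a0 sV ap; have oA := @open_ann R a.
have Cr := Cinfty_rad a0 sV; have Ca := Cinfty_ang a0 sV.
have E q : ann a q -> vcomp V 1 q = q.2 * radc V q + q.1 * angc V q.
  by move=> aq; exact: vfieldE1 (ann_neq0 a0 aq).
rewrite (partial_ext j oA ap E) partialD; first by rewrite (partial_sndM j oA Cr ap) (partial_fstM j oA Ca ap).
  exact: Cinfty_derivable (CinftyM oA (Cinfty_snd oA) Cr) ap.
exact: Cinfty_derivable (CinftyM oA (Cinfty_fst oA) Ca) ap.
Qed.

Lemma partial_vcompE a V p : 0 <= a -> smooth V -> ann a p ->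
  [/\ partial 0 (vcomp V 0) p = radc V p + p.1 * partial 0 (radc V) p - p.2 * partial 0 (angc V) p,
      partial 1 (vcomp V 0) p = p.1 * partial 1 (radc V) p - (angc V p + p.2 * partial 1 (angc V) p),
      partial 0 (vcomp V 1) p = p.2 * partial 0 (radc V) p + (angc V p + p.1 * partial 0 (angc V) p) &
      partial 1 (vcomp V 1) p = radc V p + p.2 * partial 1 (radc V) p + p.1 * partial 1 (angc V) p].
Proof.
move=> a0 sV ap; have E0 j := partial_vcomp0 j a0 sV ap; have E1 j := partial_vcomp1 j a0 sV ap.
split; [apply: etrans (E0 0) _|apply: etrans (E0 1) _|apply: etrans (E1 0) _|apply: etrans (E1 1) _].
all: move: (radc V p) (angc V p) (partial _ (radc V) p) (partial _ (angc V) p) (p.1) (p.2) => *.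
all: by rewrite ?eqxx /= !(mul1r, mul0r, add0r).
Qed.

(** The derivation t, that is d/dtheta. It has degree 0 and preserves the weight of a homogeneous
    function. *)
Definition rot f p := p.1 * partial 1 f p - p.2 * partial 0 f p.

Lemma homog_rot a n f : Cinfty (ann a) f -> homog a (fun s => s ^- n) f ->
  homog a (fun s => s ^- n) (rot f).
Proof.
move=> Cf hf s p s0 p1 p2.
rewrite /rot (homog_partial 0 Cf hf s0 p1 p2) (homog_partial 1 Cf hf s0 p1 p2) /= /GRing.scale/=.
have := lt0r_neq0 s0; move: (s ^- n) (partial 0 f p) (partial 1 f p) => w x y sn0.
by field.
Qed.

Lemma euler_rad a V p : 0 <= a -> smooth V -> radial a V -> ann a p ->
  p.1 * partial 0 (radc V) p + p.2 * partial 1 (radc V) p = - radc V p.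
Proof.
by move=> a0 sV [hr _] ap; rewrite (euler (Cinfty_rad a0 sV) hr ap) mulN1r.
Qed.

Lemma euler_ang a V p : 0 <= a -> smooth V -> radial a V -> ann a p ->
  p.1 * partial 0 (angc V) p + p.2 * partial 1 (angc V) p = 0.
Proof.
by move=> a0 sV [_ ha] ap; rewrite (euler (Cinfty_ang a0 sV) ha ap) oppr0 mul0r.
Qed.

(** As e and t commute, the bracket also contains f e(f') - f' e(f) in its radial coordinate and f
    e(g') - f' e(g) in its angular one. The first is - f f' + f' f = 0 because e(f) = - f, the
    second is 0 because e(g) = 0. *)
Lemma rad_ang_bracket a V W p : 0 <= a -> smooth V -> smooth W -> radial a V -> radial a W ->
  ann a p ->
  radc (bracket V W) p = angc V p * rot (radc W) p - angc W p * rot (radc V) p /\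
  angc (bracket V W) p = angc V p * rot (angc W) p - angc W p * rot (angc V) p.
Proof.
move=> a0 sV sW rV rW ap; have p0 := ann_neq0 a0 ap.
have key (x y f f0 f1 g g0 g1 f' f0' f1' g' g0' g1' : R) :
    x * f0 + y * f1 = - f -> x * g0 + y * g1 = 0 -> x * f0' + y * f1' = - f' -> x * g0' + y * g1' = 0 ->
    x ^+ 2 + y ^+ 2 != 0 ->
    let X0 := x * f - y * g in let X1 := y * f + x * g in
    let D00 := f + x * f0 - y * g0 in let D01 := x * f1 - (g + y * g1) in
    let D10 := y * f0 + (g + x * g0) in let D11 := f + y * f1 + x * g1 in
    let X0' := x * f' - y * g' in let X1' := y * f' + x * g' in
    let D00' := f' + x * f0' - y * g0' in let D01' := x * f1' - (g' + y * g1') in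
    let D10' := y * f0' + (g' + x * g0') in let D11' := f' + y * f1' + x * g1' in
    let Z0 := (X0 * D00' - X0' * D00) + (X1 * D01' - X1' * D01) in
    let Z1 := (X0 * D10' - X0' * D10) + (X1 * D11' - X1' * D11) in
    (x * Z0 + y * Z1) / (x ^+ 2 + y ^+ 2) = g * (x * f1' - y * f0') - g' * (x * f1 - y * f0) /\
    (x * Z1 - y * Z0) / (x ^+ 2 + y ^+ 2) = g * (x * g1' - y * g0') - g' * (x * g1 - y * g0).
  move=> E1 E2 E3 E4 xy /=; split.
    (* The vanishing e-terms are put back; what remains for [field] is then an identity that holds
       without Euler's relations. *)
    have <- : f * (x * f0' + y * f1') - f' * (x * f0 + y * f1) +
        (g * (x * f1' - y * f0') - g' * (x * f1 - y * f0)) =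
        g * (x * f1' - y * f0') - g' * (x * f1 - y * f0) by rewrite E1 E3; ring.
    by field.
  have <- : f * (x * g0' + y * g1') - f' * (x * g0 + y * g1) +
      (g * (x * g1' - y * g0') - g' * (x * g1 - y * g0)) =
      g * (x * g1' - y * g0') - g' * (x * g1 - y * g0) by rewrite E2 E4; ring.
  by field.
rewrite /rot [radc (bracket _ _) _]/radc [angc (bracket _ _) _]/angc.
have [dV00 dV10 dV01 dV11] := partial_vcompE a0 sV ap.
have [dW00 dW10 dW01 dW11] := partial_vcompE a0 sW ap.
rewrite !bracketE dV00 dV10 dV01 dV11 dW00 dW10 dW01 dW11.
rewrite (vfieldE0 V p0) (vfieldE0 W p0) (vfieldE1 V p0) (vfieldE1 W p0).
apply: key p0.
- exact: euler_rad rV ap.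
- exact: euler_ang rV ap.
- exact: euler_rad rW ap.
- exact: euler_ang rW ap.
Qed.

Lemma GVect_bracket V W : GVect_ar V -> GVect_ar W -> GVect_ar (bracket V W).
Proof.
move=> /GVect_arP[oV sV [a a01 rV]] /GVect_arP[oW sW [b b01 rW]].
have [[a0 a1] [b0 b1]] := (andP a01, andP b01).
apply/GVect_arP; split; [|exact: smooth_bracket|].
- move=> p pN; have V0 i : vcomp V i p = 0 by rewrite /vcomp oV// mxE.
  have W0 i : vcomp W i p = 0 by rewrite /vcomp oW// mxE.
  apply/rowP => i; rewrite [RHS]mxE -[LHS]/(vcomp (bracket V W) i p) bracketE.
  by rewrite !V0 !W0 !mul0r !subrr addr0.
exists (Num.max a b); first by rewrite le_max a0 gt_max a1.
set c := Num.max a b.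
have c0 : 0 <= c by rewrite le_max a0.
have rVc : radial c V by apply: radial_sub rV; rewrite le_max lexx.
have rWc : radial c W by apply: radial_sub rW; rewrite le_max lexx orbT.
have E p : ann c p -> _ := rad_ang_bracket c0 sV sW rVc rWc.
have w1 s : 0 < s -> s ^- 0 * s ^- 1 = s ^- 1 by move=> _; rewrite expr0 invr1 mul1r.
have w0 s : 0 < s -> s ^- 0 * s ^- 0 = s ^- 0 by move=> _; rewrite expr0 invr1 mul1r.
have [[hrV haV] [hrW haW]] := (rVc, rWc).
have TrV := homog_rot (Cinfty_rad c0 sV) hrV; have TaV := homog_rot (Cinfty_ang c0 sV) haV.
have TrW := homog_rot (Cinfty_rad c0 sW) hrW; have TaW := homog_rot (Cinfty_ang c0 sW) haW.
split.
- apply: (homog_ext w1 _ (homogD (homogM haV TrW) (homogN (homogM haW TrV)))).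
  by move=> p /E[->].
- apply: (homog_ext w0 _ (homogD (homogM haV TaW) (homogN (homogM haW TaV)))).
  by move=> p /E[_ ->].
Qed.

Lemma lie_subalgebra_GVect : lie_subalgebra (@GVect_ar R).
Proof. by split; [exact: GVect0|exact: GVect_lin|exact: GVect_bracket]. Qed.

End Subalgebra.

(** * The integrand *)

Section Density.
Variable R : realType.
Implicit Types (V W : vfield R) (f g : R * R -> R) (p q : R * R) (i j k : 'I_2) (a b s : R).

Definition d2 V i j k : R * R -> R := partial k (partial j (vcomp V i)).

Lemma Cinfty_d2 V i j k : smooth V -> Cinfty (@disc R) (d2 V i j k).
Proof. by move=> sV; exact: Cinfty_partial k (Cinfty_partial j (sV i)). Qed.

Lemma d2C V i j k p : smooth V -> disc p -> d2 V i j k p = d2 V i k j p.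
Proof. by move=> sV p1; exact: (partialC k j (@open_disc R) (sV i 2%N) p1). Qed.

Lemma sum_ord2 (F : 'I_2 -> R) : \sum_i F i = F 0 + F 1.
Proof.
rewrite big_ord_recl big_ord1.
by have -> : lift ord0 ord0 = 1 :> 'I_2 by exact: val_inj.
Qed.

Lemma tr_mulB2 (A B C D : 'M[R]_2) (a b c d : 'I_2 -> 'I_2 -> R) :
  (forall i j, A i j = a i j) -> (forall i j, B i j = b i j) ->
  (forall i j, C i j = c i j) -> (forall i j, D i j = d i j) ->
  \tr (A *m B - C *m D) =
  (a 0 0 * b 0 0 + a 0 1 * b 1 0 - (c 0 0 * d 0 0 + c 0 1 * d 1 0))
  + (a 1 0 * b 0 1 + a 1 1 * b 1 1 - (c 1 0 * d 0 1 + c 1 1 * d 1 1)).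
Proof. by move=> HA HB HC HD; rewrite /mxtrace sum_ord2 !mxE !sum_ord2 !(HA, HB, HC, HD). Qed.

Lemma densityE V W p : Gbeta_density V W p =
  (d2 V 0 0 0 p * d2 W 0 0 1 p + d2 V 0 1 0 p * d2 W 1 0 1 p
   - (d2 V 0 0 1 p * d2 W 0 0 0 p + d2 V 0 1 1 p * d2 W 1 0 0 p))
  + (d2 V 1 0 0 p * d2 W 0 1 1 p + d2 V 1 1 0 p * d2 W 1 1 1 p
   - (d2 V 1 0 1 p * d2 W 0 1 0 p + d2 V 1 1 1 p * d2 W 1 1 0 p)).
Proof.
have E U i j k : dmx (jac U) k p i j = d2 U i j k p.
  rewrite /dmx mxE /d2; congr (partial k _ p).
  by apply/funext => q; rewrite mxE.
exact: (tr_mulB2 (fun i j => E V i j 0) (fun i j => E W i j 1) (fun i j => E V i j 1) (fun i j => E W i j 0)).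
Qed.

Lemma Cinfty_density V W : smooth V -> smooth W -> Cinfty (@disc R) (Gbeta_density V W).
Proof.
move=> sV sW; have oD := @open_disc R.
have M i j k i' j' k' := CinftyM oD (@Cinfty_d2 V i j k sV) (@Cinfty_d2 W i' j' k' sW).
apply: (Cinfty_ext oD (fun p _ => esym (densityE V W p))).
exact: (CinftyD oD
  (CinftyB oD (CinftyD oD (M _ _ _ _ _ _) (M _ _ _ _ _ _)) (CinftyD oD (M _ _ _ _ _ _) (M _ _ _ _ _ _)))
  (CinftyB oD (CinftyD oD (M _ _ _ _ _ _) (M _ _ _ _ _ _)) (CinftyD oD (M _ _ _ _ _ _) (M _ _ _ _ _ _)))).
Qed.

Lemma homog_partial2_bounded a w f j k : 0 <= a < 1 -> (forall s, 0 < s -> w s != 0) ->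
  Cinfty (ann a) f -> homog a w f ->
  exists M, forall p, ann (shr a) p -> `|partial k (partial j f) p| <= M.
Proof.
move=> a01 w0 Cf hf.
have Cj := Cinfty_partial j Cf; have Ck := Cinfty_partial k Cj.
have h := homog_partial k Cj (homog_partial j Cf hf).
apply: (homog_bounded a01 _ (fun p ap => Cinfty_continuous Ck ap) h) => s s0.
by rewrite !mulf_neq0 ?invr_eq0 ?w0// gt_eqF.
Qed.

Lemma d2_bounded V i j k : GVect_ar V -> exists M, forall p, disc p -> `|d2 V i j k p| <= M.
Proof.
move=> /GVect_arP[_ sV [a a01 [hr ha]]]; have [a0 a1] := andP a01.
have [_ as1 s1 _] := shr_bounds a01.
have oA := @open_ann R a.
(* [A] is the component of f e, of degree 0, and [B] that of g t, of degree 1. Their sum has no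
   single degree, so each is bounded separately. *)
have [A [B [Ci [Ai [Bi [hA hB]]]]]] : exists A B, (forall p, ann a p -> vcomp V i p = A p + B p) /\
   Cinfty (ann a) A /\ Cinfty (ann a) B /\
   homog a (fun s => s * s ^- 1) A /\ homog a (fun s => s * s ^- 0) B.
  have Cr := Cinfty_rad a0 sV; have Ca := Cinfty_ang a0 sV.
  have hx : homog a id (fun q : R * R => q.1) by exact: homog_fst.
  have hy : homog a id (fun q : R * R => q.2) by exact: homog_snd.
  case: (boolP (i == 0)) => i0.
    exists (fun q => q.1 * radc V q), (fun q => - (q.2 * angc V q)).
    split; first by move=> p ap; rewrite (eqP i0); exact: vfieldE0 (ann_neq0 a0 ap).
    split; first exact: CinftyM oA (Cinfty_fst oA) Cr.
    split; first exact: CinftyN oA (CinftyM oA (Cinfty_snd oA) Ca).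
    by split; [exact: homogM|apply: homogN; exact: homogM].
  have -> : i = 1 by case: (i) i0 => [[|[|//]] i2] // _; exact: val_inj.
  exists (fun q => q.2 * radc V q), (fun q => q.1 * angc V q).
  split; first by move=> p ap; exact: vfieldE1 (ann_neq0 a0 ap).
  split; first exact: CinftyM oA (Cinfty_snd oA) Cr.
  split; first exact: CinftyM oA (Cinfty_fst oA) Ca.
  by split; exact: homogM.
have w1 n s : 0 < s -> s * s ^- n != 0 by move=> s0; rewrite mulf_neq0 ?invr_eq0 ?expf_neq0 ?gt_eqF.
have [M1 HM1] := homog_partial2_bounded j k a01 (w1 1%N) Ai hA.
have [M2 HM2] := homog_partial2_bounded j k a01 (w1 0%N) Bi hB.
apply: (@disc_bound _ _ (shr a) (M1 + M2) s1).
  by move=> p p1; exact: Cinfty_continuous (@Cinfty_d2 V i j k sV) p1.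
move=> p sp; have ap : ann a p.
  by case/andP: sp => p1 p2; rewrite /ann/= p2 andbT (lt_trans as1).
have E1 q : ann a q -> partial j (vcomp V i) q = partial j A q + partial j B q.
  move=> aq; rewrite (partial_ext j oA aq Ci) partialD//; exact: Cinfty_derivable aq.
rewrite /d2 (partial_ext k oA ap E1) partialD.
- by apply: (le_trans (ler_normD _ _)); apply: lerD; [exact: HM1|exact: HM2].
- exact: Cinfty_derivable (Cinfty_partial j Ai) ap.
- exact: Cinfty_derivable (Cinfty_partial j Bi) ap.
Qed.

Definition bounded_disc f := exists M, forall p, disc p -> `|f p| <= M.

Lemma bounded_discM f g : bounded_disc f -> bounded_disc g -> bounded_disc (fun p => f p * g p).
Proof.
move=> [M HM] [M' HM']; exists (M * M') => p p1.
by rewrite normrM; apply: ler_pM => //; [exact: HM|exact: HM'].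
Qed.

Lemma bounded_discD f g : bounded_disc f -> bounded_disc g -> bounded_disc (fun p => f p + g p).
Proof.
move=> [M HM] [M' HM']; exists (M + M') => p p1.
by apply: (le_trans (ler_normD _ _)); apply: lerD; [exact: HM|exact: HM'].
Qed.

Lemma bounded_discB f g : bounded_disc f -> bounded_disc g -> bounded_disc (fun p => f p - g p).
Proof.
move=> [M HM] [M' HM']; exists (M + M') => p p1.
by apply: (le_trans (ler_normB _ _)); apply: lerD; [exact: HM|exact: HM'].
Qed.

Lemma density_bounded V W : GVect_ar V -> GVect_ar W -> bounded_disc (Gbeta_density V W).
Proof.
move=> gV gW.
have H i j k i' j' k' := bounded_discM (@d2_bounded V i j k gV) (@d2_bounded W i' j' k' gW).
have [M HM] := bounded_discD
  (bounded_discB (bounded_discD (H 0 0 0 0 0 1) (H 0 1 0 1 0 1)) (bounded_discD (H 0 0 1 0 0 0) (H 0 1 1 1 0 0)))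
  (bounded_discB (bounded_discD (H 1 0 0 0 1 1) (H 1 1 0 1 1 1)) (bounded_discD (H 1 0 1 0 1 0) (H 1 1 1 1 1 0))).
by exists M => p p1; rewrite densityE; exact: HM.
Qed.

(** A, B, C are the entries of a symmetric form with value 0 on (e, e), P on (e, t) and Q on (t, t).
    As e and t are orthogonal of length r, inverting the change of frame costs r^4. *)
Lemma frame2 (x y A B C P : R) : x ^+ 2 + y ^+ 2 != 0 ->
  x ^+ 2 * A + 2 * x * y * B + y ^+ 2 * C = 0 ->
  (x ^+ 2 - y ^+ 2) * B + x * y * (C - A) = P ->
  let Q := y ^+ 2 * A - 2 * x * y * B + x ^+ 2 * C in
  [/\ A = (- 2 * x * y * P + y ^+ 2 * Q) / (x ^+ 2 + y ^+ 2) ^+ 2,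
      B = ((x ^+ 2 - y ^+ 2) * P - x * y * Q) / (x ^+ 2 + y ^+ 2) ^+ 2 &
      C = (2 * x * y * P + x ^+ 2 * Q) / (x ^+ 2 + y ^+ 2) ^+ 2].
Proof.
move=> r0 He HP Q.
split.
- transitivity ((x ^+ 2 * (x ^+ 2 * A + 2 * x * y * B + y ^+ 2 * C) - 2 * x * y * P + y ^+ 2 * Q) / (x ^+ 2 + y ^+ 2) ^+ 2).
    by rewrite -HP /Q; field.
  by rewrite He; congr (_ / _); ring.
- transitivity ((x * y * (x ^+ 2 * A + 2 * x * y * B + y ^+ 2 * C) + (x ^+ 2 - y ^+ 2) * P - x * y * Q) / (x ^+ 2 + y ^+ 2) ^+ 2).
    by rewrite -HP /Q; field.
  by rewrite He; congr (_ / _); ring.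
- transitivity ((y ^+ 2 * (x ^+ 2 * A + 2 * x * y * B + y ^+ 2 * C) + 2 * x * y * P + x ^+ 2 * Q) / (x ^+ 2 + y ^+ 2) ^+ 2).
    by rewrite -HP /Q; field.
  by rewrite He; congr (_ / _); ring.
Qed.

(* Near the circle the Hessian of V_i vanishes on (e, e), so it is determined by its
   values P_i on (e, t) and Q_i on (t, t), in the frame e = (x, y), t = (-y, x). Here
   P = - (t(f) e + f t), and [al], [be] are the coordinates of Q in the frame. *)
Definition hess_jet (x y f t al be A0 B0 C0 A1 B1 C1 : R) :=
  let P0 := - (t * x - f * y) in let P1 := - (t * y + f * x) in
  let Q0 := al * x - be * y in let Q1 := al * y + be * x in
  let r4 := (x ^+ 2 + y ^+ 2) ^+ 2 in
  [/\ A0 = (- 2 * x * y * P0 + y ^+ 2 * Q0) / r4, B0 = ((x ^+ 2 - y ^+ 2) * P0 - x * y * Q0) / r4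
    & C0 = (2 * x * y * P0 + x ^+ 2 * Q0) / r4] /\
  [/\ A1 = (- 2 * x * y * P1 + y ^+ 2 * Q1) / r4, B1 = ((x ^+ 2 - y ^+ 2) * P1 - x * y * Q1) / r4
    & C1 = (2 * x * y * P1 + x ^+ 2 * Q1) / r4].

(** The Hessian of a homogeneous function u of degree m is m (m - 1) u on (e, e) and (m - 1) t(u) on
    (e, t). The components of f e have degree 0 and those of g t degree 1: the first value vanishes
    for both, and the second is - t(f e) in all. The last six arguments of [hess_jet] are the second
    derivatives of x f - y g and y f + x g. *)
Lemma hess_jet_exists (x y f f0 f1 f00 f01 f11 g0 g1 g00 g01 g11 : R) :
  x ^+ 2 + y ^+ 2 != 0 ->
  x * f0 + y * f1 = - f -> x * g0 + y * g1 = 0 ->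
  x * f00 + y * f01 = - 2 * f0 -> x * f01 + y * f11 = - 2 * f1 ->
  x * g00 + y * g01 = - g0 -> x * g01 + y * g11 = - g1 ->
  exists t al be, hess_jet x y f t al be
    (2 * f0 + x * f00 - y * g00) (f1 + x * f01 - g0 - y * g01) (x * f11 - 2 * g1 - y * g11)
    (y * f00 + 2 * g0 + x * g00) (f0 + y * f01 + g1 + x * g01) (2 * f1 + y * f11 + x * g11).
Proof.
move=> r0 Ef Eg Ef0 Ef1 Eg0 Eg1.
set A0 := 2 * f0 + _ - _; set B0 := _ - y * g01; set C0 := _ - y * g11.
set A1 := y * f00 + _ + _; set B1 := _ + x * g01; set C1 := _ + x * g11.
have f_E : f = - (x * f0 + y * f1) by rewrite Ef opprK.
have He0 : x ^+ 2 * A0 + 2 * x * y * B0 + y ^+ 2 * C0 = 0.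
  transitivity (2 * x * (x * f0 + y * f1) - 2 * y * (x * g0 + y * g1)
     + x * (x * (x * f00 + y * f01) + y * (x * f01 + y * f11))
     - y * (x * (x * g00 + y * g01) + y * (x * g01 + y * g11))); first by rewrite /A0 /B0 /C0; ring.
  rewrite Ef0 Ef1 Eg0 Eg1; transitivity (- (y * (x * g0 + y * g1))); first by ring.
  by rewrite Eg mulr0 oppr0.
have He1 : x ^+ 2 * A1 + 2 * x * y * B1 + y ^+ 2 * C1 = 0.
  transitivity (2 * y * (x * f0 + y * f1) + 2 * x * (x * g0 + y * g1)
     + y * (x * (x * f00 + y * f01) + y * (x * f01 + y * f11))
     + x * (x * (x * g00 + y * g01) + y * (x * g01 + y * g11))); first by rewrite /A1 /B1 /C1; ring.
  rewrite Ef0 Ef1 Eg0 Eg1; transitivity (x * (x * g0 + y * g1)); first by ring.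
  by rewrite Eg mulr0.
pose t := x * f1 - y * f0.
have HP0 : (x ^+ 2 - y ^+ 2) * B0 + x * y * (C0 - A0) = - (t * x - f * y).
  transitivity (x * (x * (x * f01 + y * f11) - y * (x * f00 + y * f01))
    - y * (x * (x * g01 + y * g11) - y * (x * g00 + y * g01))
    + (x ^+ 2 - y ^+ 2) * (f1 - g0) - 2 * x * y * (g1 + f0)); first by rewrite /A0 /B0 /C0; ring.
  rewrite Ef0 Ef1 Eg0 Eg1; transitivity (- (t * x - f * y) - x * (x * g0 + y * g1)).
    by rewrite /t f_E; ring.
  by rewrite Eg mulr0 subr0.
have HP1 : (x ^+ 2 - y ^+ 2) * B1 + x * y * (C1 - A1) = - (t * y + f * x).
  transitivity (y * (x * (x * f01 + y * f11) - y * (x * f00 + y * f01))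
    + x * (x * (x * g01 + y * g11) - y * (x * g00 + y * g01))
    + (x ^+ 2 - y ^+ 2) * (f0 + g1) + 2 * x * y * (f1 - g0)); first by rewrite /A1 /B1 /C1; ring.
  rewrite Ef0 Ef1 Eg0 Eg1; transitivity (- (t * y + f * x) - y * (x * g0 + y * g1)).
    by rewrite /t f_E; ring.
  by rewrite Eg mulr0 subr0.
have [] := (frame2 r0 He0 HP0, frame2 r0 He1 HP1).
set Q0 := y ^+ 2 * A0 - _ + _; set Q1 := y ^+ 2 * A1 - _ + _ => F0 F1.
exists t, ((x * Q0 + y * Q1) / (x ^+ 2 + y ^+ 2)), ((x * Q1 - y * Q0) / (x ^+ 2 + y ^+ 2)).
have E0 : (x * Q0 + y * Q1) / (x ^+ 2 + y ^+ 2) * x - (x * Q1 - y * Q0) / (x ^+ 2 + y ^+ 2) * y = Q0.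
  by move: (Q0) (Q1) => u v; field.
have E1 : (x * Q0 + y * Q1) / (x ^+ 2 + y ^+ 2) * y + (x * Q1 - y * Q0) / (x ^+ 2 + y ^+ 2) * x = Q1.
  by move: (Q0) (Q1) => u v; field.
by rewrite /hess_jet E0 E1; split.
Qed.

(** In the frame e, t the matrix dJ_V(e) has columns 0, P and dJ_V(t) has columns P, Q. The trace of
    dJ_V(e) dJ_W(t) - dJ_V(t) dJ_W(e) is then the right-hand side, [al] dropping out, and r^2 is the
    area spanned by e and t. *)
Lemma hess_jet_pairing (x y f t al be A0 B0 C0 A1 B1 C1 f' t' al' be' A0' B0' C0' A1' B1' C1' : R) :
  x ^+ 2 + y ^+ 2 != 0 ->
  hess_jet x y f t al be A0 B0 C0 A1 B1 C1 -> hess_jet x y f' t' al' be' A0' B0' C0' A1' B1' C1' ->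
  (x ^+ 2 + y ^+ 2) * ((A0 * B0' + B0 * B1' - (B0 * A0' + C0 * A1'))
     + (A1 * C0' + B1 * C1' - (B1 * B0' + C1 * B1'))) =
  f' * (be + t) - f * (be' + t').
Proof.
move=> r0 [[-> -> ->] [-> -> ->]] [[-> -> ->] [-> -> ->]].
by field.
Qed.

End Density.

(** * The cyclic sum as a divergence *)

Section Divergence.
Variable R : realType.
Implicit Types (O : set (R * R)) (V W U : vfield R) (f g : R * R -> R) (p q : R * R) (i j k l m : 'I_2) (a b s : R).

(** Smoothness and the value of a derivative travel together, so that the derivative of a large
    expression is assembled by applying the rules along its shape. *)
Definition has_partial O f k p d := Cinfty O f /\ partial k f p = d.

Lemma has_partialD O f g k p d e : open O -> O p ->
  has_partial O f k p d -> has_partial O g k p e ->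
  has_partial O (fun q => f q + g q) k p (d + e).
Proof.
move=> oO Op [Cf <-] [Cg <-]; split; first exact: CinftyD.
by apply: partialD; [exact: Cinfty_derivable Cf Op|exact: Cinfty_derivable Cg Op].
Qed.

Lemma has_partialB O f g k p d e : open O -> O p ->
  has_partial O f k p d -> has_partial O g k p e ->
  has_partial O (fun q => f q - g q) k p (d - e).
Proof.
move=> oO Op [Cf <-] [Cg <-]; split; first exact: CinftyB.
by apply: partialB; [exact: Cinfty_derivable Cf Op|exact: Cinfty_derivable Cg Op].
Qed.

Lemma has_partialM O f g k p d e : open O -> O p ->
  has_partial O f k p d -> has_partial O g k p e ->
  has_partial O (fun q => f q * g q) k p (d * g p + f p * e).
Proof.
move=> oO Op [Cf <-] [Cg <-]; split; first exact: CinftyM.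
rewrite partialM; first by rewrite addrC (mulrC (g p)).
  exact: Cinfty_derivable Cf Op.
exact: Cinfty_derivable Cg Op.
Qed.

Lemma has_partial_fst O f k p d : open O -> O p -> has_partial O f k p d ->
  has_partial O (fun q => q.1 * f q) k p ((k == 0)%:R * f p + p.1 * d).
Proof.
move=> oO Op [Cf <-]; split; first exact: CinftyM oO (Cinfty_fst oO) Cf.
exact: partial_fstM oO Cf Op.
Qed.

Lemma has_partial_snd O f k p d : open O -> O p -> has_partial O f k p d ->
  has_partial O (fun q => q.2 * f q) k p ((k != 0)%:R * f p + p.2 * d).
Proof.
move=> oO Op [Cf <-]; split; first exact: CinftyM oO (Cinfty_snd oO) Cf.
exact: partial_sndM oO Cf Op.
Qed.

Lemma has_partial_refl O f k p : Cinfty O f -> has_partial O f k p (partial k f p).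
Proof. by []. Qed.

Lemma partial_has O f g k p d : open O -> O p -> (forall q, O q -> f q = g q) ->
  has_partial O g k p d -> partial k f p = d.
Proof. by move=> oO Op fg [_ <-]; exact: partial_ext oO Op fg. Qed.

Lemma hess_jet_eq (x y f t al be A B C D E F A' B' C' D' E' F' : R) :
  A = A' -> B = B' -> C = C' -> D = D' -> E = E' -> F = F' ->
  hess_jet x y f t al be A B C D E F -> hess_jet x y f t al be A' B' C' D' E' F'.
Proof. by move=> -> -> -> -> -> ->. Qed.

Lemma hess_jet_ann a V p : 0 <= a -> smooth V -> radial a V -> ann a p ->
  exists t al be, hess_jet p.1 p.2 (radc V p) t al be
    (d2 V 0 0 0 p) (d2 V 0 1 0 p) (d2 V 0 1 1 p) (d2 V 1 0 0 p) (d2 V 1 1 0 p) (d2 V 1 1 1 p).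
Proof.
move=> a0 sV rV ap; have oA := @open_ann R a.
have Cf := Cinfty_rad a0 sV; have Cg := Cinfty_ang a0 sV.
set f := radc V in Cf *; set g := angc V in Cg *.
have hf j := has_partial_refl j p Cf; have hg j := has_partial_refl j p Cg.
have Cfj j := Cinfty_partial j Cf; have Cgj j := Cinfty_partial j Cg.
have hfj j k := has_partial_refl k p (Cfj j); have hgj j k := has_partial_refl k p (Cgj j).
have J q (aq : ann a q) := partial_vcompE a0 sV aq.
have E00 q : ann a q -> partial 0 (vcomp V 0) q = f q + q.1 * partial 0 f q - q.2 * partial 0 g q.
  by move=> /J[].
have E01 q : ann a q -> partial 1 (vcomp V 0) q = q.1 * partial 1 f q - (g q + q.2 * partial 1 g q).
  by move=> /J[].
have E10 q : ann a q -> partial 0 (vcomp V 1) q = q.2 * partial 0 f q + (g q + q.1 * partial 0 g q).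
  by move=> /J[].
have E11 q : ann a q -> partial 1 (vcomp V 1) q = f q + q.2 * partial 1 f q + q.1 * partial 1 g q.
  by move=> /J[].
have D000 := partial_has oA ap E00 (has_partialB oA ap (has_partialD oA ap (hf 0)
  (has_partial_fst oA ap (hfj 0 0))) (has_partial_snd oA ap (hgj 0 0))).
have D010 := partial_has oA ap E01 (has_partialB oA ap (has_partial_fst oA ap (hfj 1 0))
  (has_partialD oA ap (hg 0) (has_partial_snd oA ap (hgj 1 0)))).
have D011 := partial_has oA ap E01 (has_partialB oA ap (has_partial_fst oA ap (hfj 1 1))
  (has_partialD oA ap (hg 1) (has_partial_snd oA ap (hgj 1 1)))).
have D100 := partial_has oA ap E10 (has_partialD oA ap (has_partial_snd oA ap (hfj 0 0))
  (has_partialD oA ap (hg 0) (has_partial_fst oA ap (hgj 0 0)))).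
have D110 := partial_has oA ap E11 (has_partialD oA ap (has_partialD oA ap (hf 0)
  (has_partial_snd oA ap (hfj 1 0))) (has_partial_fst oA ap (hgj 1 0))).
have D111 := partial_has oA ap E11 (has_partialD oA ap (has_partialD oA ap (hf 1)
  (has_partial_snd oA ap (hfj 1 1))) (has_partial_fst oA ap (hgj 1 1))).
have [hrf hag] := rV.
have w2 s : 0 < s -> s ^- 1 / s = s ^- 2.
  by move=> s0; rewrite expr1 -invfM -expr2.
have w1 s : 0 < s -> s ^- 0 / s = s ^- 1 by move=> s0; rewrite expr0 invr1 mul1r expr1.
have hfe j : homog a (fun s => s ^- 2) (partial j f).
  by apply: (homog_ext w2 _ (homog_partial j Cf hrf)).
have hge j : homog a (fun s => s ^- 1) (partial j g).
  by apply: (homog_ext w1 _ (homog_partial j Cg hag)).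
have Ef j : p.1 * partial 0 (partial j f) p + p.2 * partial 1 (partial j f) p = - 2 * partial j f p.
  exact: euler (Cfj j) (hfe j) ap.
have Eg j : p.1 * partial 0 (partial j g) p + p.2 * partial 1 (partial j g) p = - partial j g p.
  by rewrite -mulN1r; exact: euler (Cgj j) (hge j) ap.
have Sf : partial 1 (partial 0 f) p = partial 0 (partial 1 f) p := partialC 1 0 oA (Cf 2%N) ap.
have Sg : partial 1 (partial 0 g) p = partial 0 (partial 1 g) p := partialC 1 0 oA (Cg 2%N) ap.
have Ef0 := Ef 0; have Ef1 := Ef 1; have Eg0 := Eg 0; have Eg1 := Eg 1.
(* [hess_jet_exists] has a single variable for the two mixed derivatives of f, and one for those of
   g. *)
rewrite Sf in Ef0; rewrite Sg in Eg0.
have p0 := ann_neq0 a0 ap.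
have [t [al [be H]]] := hess_jet_exists p0 (euler_rad a0 sV rV ap) (euler_ang a0 sV rV ap) Ef0 Ef1 Eg0 Eg1.
exists t, al, be.
apply: hess_jet_eq H; apply: esym.
- apply: etrans D000 _; move: (partial 0 f p) (partial 0 (partial 0 f) p) (partial 0 g p) (partial 0 (partial 0 g) p) => *.
  by rewrite /=; ring.
- apply: etrans D010 _; move: (partial 1 f p) (partial 0 (partial 1 f) p) (partial 0 g p) (partial 1 g p) (partial 0 (partial 1 g) p) => *.
  by rewrite /=; ring.
- apply: etrans D011 _; move: (partial 1 f p) (partial 1 (partial 1 f) p) (partial 1 g p) (partial 1 (partial 1 g) p) => *.
  by rewrite /=; ring.
- apply: etrans D100 _; move: (partial 0 f p) (partial 0 (partial 0 f) p) (partial 0 g p) (partial 0 (partial 0 g) p) => *.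
  by rewrite /=; ring.
- apply: etrans D110 _; move: (partial 0 f p) (partial 1 f p) (partial 0 (partial 1 f) p) (partial 1 g p) (partial 0 (partial 1 g) p) => *.
  by rewrite /=; ring.
- apply: etrans D111 _; move: (partial 1 f p) (partial 1 (partial 1 f) p) (partial 1 g p) (partial 1 (partial 1 g) p) => *.
  by rewrite /=; ring.
Qed.

(** * The cyclic sum as a polynomial identity in jets *)

Definition wedge2 (u w : 'I_2 -> 'I_2 -> 'I_2 -> R) : R :=
  (u 0 0 0 * w 0 0 1 + u 0 1 0 * w 1 0 1 - (u 0 0 1 * w 0 0 0 + u 0 1 1 * w 1 0 0))
  + (u 1 0 0 * w 0 1 1 + u 1 1 0 * w 1 1 1 - (u 1 0 1 * w 0 1 0 + u 1 1 1 * w 1 1 0)).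

(* Second derivatives of [V, W]_i, given the jets [v], [w] of V and W. *)
Definition bracket2 (v w : 'I_2 -> R) (v1 w1 : 'I_2 -> 'I_2 -> R) (v2 w2 : 'I_2 -> 'I_2 -> 'I_2 -> R)
    (v3 w3 : 'I_2 -> 'I_2 -> 'I_2 -> 'I_2 -> R) i j k : R :=
  let T m :=
    (v2 m j k * w1 i m + v1 m j * w2 i m k) + (v1 m k * w2 i m j + v m * w3 i m j k)
    - ((w2 m j k * v1 i m + w1 m j * v2 i m k) + (w1 m k * v2 i m j + w m * v3 i m j k)) in
  T 0 + T 1.

(** The divergence of V tr(dJ_W /\ dJ_U), given the jets of V, W and U. *)
Definition flux_div (v : 'I_2 -> R) (v1 : 'I_2 -> 'I_2 -> R) (w2 u2 : 'I_2 -> 'I_2 -> 'I_2 -> R)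
    (w3 u3 : 'I_2 -> 'I_2 -> 'I_2 -> 'I_2 -> R) : R :=
  let T m := v1 m m * wedge2 w2 u2 +
    v m * (wedge2 (fun i j k => w3 i j k m) u2 + wedge2 w2 (fun i j k => u3 i j k m)) in
  T 0 + T 1.

(** Here and in [sym3] the equations are oriented towards decreasing indices, so that after
    rewriting equal derivatives are one variable for [ring]. *)
Definition sym2 (v2 : 'I_2 -> 'I_2 -> 'I_2 -> R) := forall i, v2 i 0 1 = v2 i 1 0.

Definition sym3 (v3 : 'I_2 -> 'I_2 -> 'I_2 -> 'I_2 -> R) := forall i,
  [/\ v3 i 0 0 1 = v3 i 1 0 0, v3 i 0 1 0 = v3 i 1 0 0, v3 i 0 1 1 = v3 i 1 1 0 & v3 i 1 0 1 = v3 i 1 1 0].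

(** The derivatives at a point are treated as independent variables: beyond the symmetry of mixed
    derivatives, the identity is purely polynomial. *)
Lemma cyclic_jets (v w u : 'I_2 -> R) (v1 w1 u1 : 'I_2 -> 'I_2 -> R)
    (v2 w2 u2 : 'I_2 -> 'I_2 -> 'I_2 -> R) (v3 w3 u3 : 'I_2 -> 'I_2 -> 'I_2 -> 'I_2 -> R) :
  sym2 v2 -> sym2 w2 -> sym2 u2 -> sym3 v3 -> sym3 w3 -> sym3 u3 ->
  wedge2 (bracket2 v w v1 w1 v2 w2 v3 w3) u2 + wedge2 (bracket2 w u w1 u1 w2 u2 w3 u3) v2
    + wedge2 (bracket2 u v u1 v1 u2 v2 u3 v3) w2 =
  flux_div v v1 w2 u2 w3 u3 + flux_div w w1 u2 v2 u3 v3 + flux_div u u1 v2 w2 v3 w3.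
Proof.
move=> sv sw su tv tw tu; rewrite /flux_div /wedge2 /bracket2.
rewrite !(sv 0) !(sv 1) !(sw 0) !(sw 1) !(su 0) !(su 1).
have [-> -> -> ->] := tv 0; have [-> -> -> ->] := tv 1.
have [-> -> -> ->] := tw 0; have [-> -> -> ->] := tw 1.
have [-> -> -> ->] := tu 0; have [-> -> -> ->] := tu 1.
by ring.
Qed.

Lemma densityE2 V W p : Gbeta_density V W p =
  wedge2 (fun i j k => d2 V i j k p) (fun i j k => d2 W i j k p).
Proof. exact: densityE. Qed.

Definition d3 V i j k l : R * R -> R := partial l (d2 V i j k).

Lemma sym2_d2 V p : smooth V -> disc p -> sym2 (fun i j k => d2 V i j k p).
Proof. by move=> sV p1 i; exact: d2C. Qed.

Lemma sym3_d3 V p : smooth V -> disc p -> sym3 (fun i j k l => d3 V i j k l p).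
Proof.
move=> sV p1.
have C i j k l : d3 V i j k l p = d3 V i k j l p.
  by apply: (partial_ext l (@open_disc R) p1) => q q1; exact: d2C.
have C' i j k l : d3 V i j k l p = d3 V i j l k p.
  exact: (partialC l k (@open_disc R) (Cinfty_partial j (sV i) 2%N) p1).
move=> i; split.
- exact: etrans (C' _ _ _ _) (C _ _ _ _).
- exact: C.
- exact: etrans (C _ _ _ _) (C' _ _ _ _).
- exact: C'.
Qed.

Lemma d2_bracket V W i j k p : smooth V -> smooth W -> disc p ->
  d2 (bracket V W) i j k p =
  bracket2 (fun m => vcomp V m p) (fun m => vcomp W m p)
    (fun m l => partial l (vcomp V m) p) (fun m l => partial l (vcomp W m) p)
    (fun m l n => d2 V m l n p) (fun m l n => d2 W m l n p)
    (fun m l n o => d3 V m l n o p) (fun m l n o => d3 W m l n o p) i j k.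
Proof.
move=> sV sW p1; have oD := @open_disc R.
have B q : disc q -> partial j (vcomp (bracket V W) i) q =
   ((partial j (vcomp V 0) q * partial 0 (vcomp W i) q + vcomp V 0 q * d2 W i 0 j q)
   - (partial j (vcomp W 0) q * partial 0 (vcomp V i) q + vcomp W 0 q * d2 V i 0 j q))
  + ((partial j (vcomp V 1) q * partial 1 (vcomp W i) q + vcomp V 1 q * d2 W i 1 j q)
   - (partial j (vcomp W 1) q * partial 1 (vcomp V i) q + vcomp W 1 q * d2 V i 1 j q)).
  move=> q1.
  have h0 U (sU : smooth U) m l := has_partial_refl l q (sU m).
  have h1 U (sU : smooth U) m l n := has_partial_refl n q (Cinfty_partial l (sU m)).
  have T U U' (sU : smooth U) (sU' : smooth U') m := has_partialM oD q1 (h0 U sU m j) (h1 U' sU' i m j).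
  exact: (partial_has oD q1 (fun q _ => bracketE V W i q) (has_partialD oD q1
    (has_partialB oD q1 (T V W sV sW 0) (T W V sW sV 0)) (has_partialB oD q1 (T V W sV sW 1) (T W V sW sV 1)))).
have h0 U (sU : smooth U) m l := has_partial_refl l p (sU m).
have h1 U (sU : smooth U) m l n := has_partial_refl n p (Cinfty_partial l (sU m)).
have h2 U (sU : smooth U) m l n o := has_partial_refl o p (@Cinfty_d2 R U m l n sU).
have T U U' (sU : smooth U) (sU' : smooth U') m := has_partialD oD p1
  (has_partialM oD p1 (h1 U sU m j k) (h1 U' sU' i m k))
  (has_partialM oD p1 (h0 U sU m k) (h2 U' sU' i m j k)).
exact: (partial_has oD p1 B (has_partialD oD p1
    (has_partialB oD p1 (T V W sV sW 0) (T W V sW sV 0)) (has_partialB oD p1 (T V W sV sW 1) (T W V sW sV 1)))).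
Qed.

Lemma wedge2_eq (u w u' w' : 'I_2 -> 'I_2 -> 'I_2 -> R) :
  (forall i j k, u i j k = u' i j k) -> (forall i j k, w i j k = w' i j k) ->
  wedge2 u w = wedge2 u' w'.
Proof. by move=> uu ww; rewrite /wedge2 !uu !ww. Qed.

Lemma partial_density V W l p : smooth V -> smooth W -> disc p ->
  has_partial (@disc R) (Gbeta_density V W) l p
    (wedge2 (fun i j k => d3 V i j k l p) (fun i j k => d2 W i j k p)
     + wedge2 (fun i j k => d2 V i j k p) (fun i j k => d3 W i j k l p)).
Proof.
move=> sV sW p1; have oD := @open_disc R.
split; first exact: Cinfty_density.
have h U (sU : smooth U) i j k := has_partial_refl l p (@Cinfty_d2 R U i j k sU).
have M i j k i' j' k' := has_partialM oD p1 (h V sV i j k) (h W sW i' j' k').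
have := partial_has oD p1 (fun q _ => densityE V W q) (has_partialD oD p1
  (has_partialB oD p1 (has_partialD oD p1 (M _ _ _ _ _ _) (M _ _ _ _ _ _)) (has_partialD oD p1 (M _ _ _ _ _ _) (M _ _ _ _ _ _)))
  (has_partialB oD p1 (has_partialD oD p1 (M _ _ _ _ _ _) (M _ _ _ _ _ _)) (has_partialD oD p1 (M _ _ _ _ _ _) (M _ _ _ _ _ _)))).
move=> E; apply: etrans E _; rewrite /wedge2 /d3.
have R8 (a b c d e f u v a' b' c' d' e' f' u' v' : R) :
   (a + a' + (b + b') - (c + c' + (d + d'))) + (e + e' + (f + f') - (u + u' + (v + v'))) =
   ((a + b - (c + d)) + (e + f - (u + v))) + ((a' + b' - (c' + d')) + (e' + f' - (u' + v'))) by ring.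
exact: R8.
Qed.

Definition flux V W U m p : R :=
  vcomp V m p * Gbeta_density W U p + vcomp W m p * Gbeta_density U V p
  + vcomp U m p * Gbeta_density V W p.

Lemma Cinfty_flux V W U m : smooth V -> smooth W -> smooth U -> Cinfty (@disc R) (flux V W U m).
Proof.
move=> sV sW sU; have oD := @open_disc R.
exact: (CinftyD oD (CinftyD oD (CinftyM oD (sV m) (Cinfty_density sW sU))
  (CinftyM oD (sW m) (Cinfty_density sU sV))) (CinftyM oD (sU m) (Cinfty_density sV sW))).
Qed.

Lemma cyclic_divergence V W U p : smooth V -> smooth W -> smooth U -> disc p ->
  Gbeta_density (bracket V W) U p + Gbeta_density (bracket W U) V p + Gbeta_density (bracket U V) W p
  = partial 0 (flux V W U 0) p + partial 1 (flux V W U 1) p.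
Proof.
move=> sV sW sU p1; have oD := @open_disc R.
have h X (sX : smooth X) m := has_partial_refl m p (sX m).
have P m := partial_has oD p1 (fun q _ => erefl (flux V W U m q)) (has_partialD oD p1 (has_partialD oD p1
  (has_partialM oD p1 (h V sV m) (partial_density m sW sU p1))
  (has_partialM oD p1 (h W sW m) (partial_density m sU sV p1)))
  (has_partialM oD p1 (h U sU m) (partial_density m sV sW p1))).
have L X Y Z (sX : smooth X) (sY : smooth Y) := etrans (densityE2 (bracket X Y) Z p)
  (wedge2_eq (fun i j k => d2_bracket i j k sX sY p1) (fun i j k => erefl (d2 Z i j k p))).
have Fd X Y Z : flux_div (fun m => vcomp X m p) (fun m l => partial l (vcomp X m) p)
    (fun i j k => d2 Y i j k p) (fun i j k => d2 Z i j k p)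
    (fun i j k l => d3 Y i j k l p) (fun i j k l => d3 Z i j k l p) =
    (partial 0 (vcomp X 0) p * Gbeta_density Y Z p + vcomp X 0 p *
      (wedge2 (fun i j k => d3 Y i j k 0 p) (fun i j k => d2 Z i j k p)
     + wedge2 (fun i j k => d2 Y i j k p) (fun i j k => d3 Z i j k 0 p)))
  + (partial 1 (vcomp X 1) p * Gbeta_density Y Z p + vcomp X 1 p *
      (wedge2 (fun i j k => d3 Y i j k 1 p) (fun i j k => d2 Z i j k p)
     + wedge2 (fun i j k => d2 Y i j k p) (fun i j k => d3 Z i j k 1 p))).
  by rewrite /flux_div densityE2.
have R6 (a0 a1 b0 b1 c0 c1 : R) :
  (a0 + a1) + (b0 + b1) + (c0 + c1) = (a0 + b0 + c0) + (a1 + b1 + c1) by ring.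
apply: etrans (congr2 +%R (congr2 +%R (L _ _ U sV sW) (L _ _ V sW sU)) (L _ _ W sU sV)) _.
apply: etrans (cyclic_jets _ _ _ _ _ _ (sym2_d2 sV p1) (sym2_d2 sW p1) (sym2_d2 sU p1)
  (sym3_d3 sV p1) (sym3_d3 sW p1) (sym3_d3 sU p1)) _.
apply: etrans (congr2 +%R (congr2 +%R (Fd V W U) (Fd W U V)) (Fd U V W)) _.
exact: etrans (R6 _ _ _ _ _ _) (esym (congr2 +%R (P 0) (P 1))).
Qed.

Lemma wedge2_sym (u w : 'I_2 -> 'I_2 -> 'I_2 -> R) : sym2 u -> sym2 w -> wedge2 u w =
  (u 0 0 0 * w 0 1 0 + u 0 1 0 * w 1 1 0 - (u 0 1 0 * w 0 0 0 + u 0 1 1 * w 1 0 0))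
  + (u 1 0 0 * w 0 1 1 + u 1 1 0 * w 1 1 1 - (u 1 1 0 * w 0 1 0 + u 1 1 1 * w 1 1 0)).
Proof. by move=> su sw; rewrite /wedge2 (su 0) (su 1) (sw 0) (sw 1). Qed.

(* In polar coordinates r^2 times the density is f_W c_V - f_V c_W for a function c_V
   depending on V alone, and the radial part of the flux is an alternating sum of these. *)
Lemma flux_tangent a V W U p : 0 <= a -> smooth V -> smooth W -> smooth U ->
  radial a V -> radial a W -> radial a U -> ann a p ->
  p.1 * flux V W U 0 p + p.2 * flux V W U 1 p = 0.
Proof.
move=> a0 sV sW sU rV rW rU ap; have p0 := ann_neq0 a0 ap; have p1 := @ann_disc R a p ap.
have [tV [aV [bV HV]]] := hess_jet_ann a0 sV rV ap.
have [tW [aW [bW HW]]] := hess_jet_ann a0 sW rW ap.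
have [tU [aU [bU HU]]] := hess_jet_ann a0 sU rU ap.
have D X Y (sX : smooth X) (sY : smooth Y) :=
  etrans (densityE2 X Y p) (wedge2_sym (sym2_d2 sX p1) (sym2_d2 sY p1)).
have VW := etrans (congr1 ( *%R _) (D _ _ sV sW)) (hess_jet_pairing p0 HV HW).
have WU := etrans (congr1 ( *%R _) (D _ _ sW sU)) (hess_jet_pairing p0 HW HU).
have UV := etrans (congr1 ( *%R _) (D _ _ sU sV)) (hess_jet_pairing p0 HU HV).
have Rad X : p.1 * vcomp X 0 p + p.2 * vcomp X 1 p = sq p * radc X p.
  exact: esym (etrans (mulrC _ _) (divfK p0 _)).
have alg (x y v0 v1 w0 w1 u0 u1 r fv fw fu cvw cwu cuv gv gw gu : R) :
    r * cvw = fw * gv - fv * gw -> r * cwu = fu * gw - fw * gu -> r * cuv = fv * gu - fu * gv ->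
    x * v0 + y * v1 = r * fv -> x * w0 + y * w1 = r * fw -> x * u0 + y * u1 = r * fu ->
    x * (v0 * cwu + w0 * cuv + u0 * cvw) + y * (v1 * cwu + w1 * cuv + u1 * cvw) = 0.
  move=> E1 E2 E3 F1 F2 F3.
  transitivity ((x * v0 + y * v1) * cwu + (x * w0 + y * w1) * cuv + (x * u0 + y * u1) * cvw); first by ring.
  rewrite F1 F2 F3; transitivity (fv * (r * cwu) + fw * (r * cuv) + fu * (r * cvw)); first by ring.
  by rewrite E1 E2 E3; ring.
exact: alg VW WU UV (Rad V) (Rad W) (Rad U).
Qed.

End Divergence.

(** * Integration over the disc *)

Section Integration.
Variable R : realType.
Implicit Types (f g G : R * R -> R) (p q : R * R) (j : 'I_2) (a b s : R).

Let box (c : (rat * rat) * (rat * rat)) : set (R * R) :=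
  `]ratr c.1.1, ratr c.1.2[ `*` `]ratr c.2.1, ratr c.2.2[.

(** Measurability is for the product of two sigma-algebras, so an open set is written as a countable
    union of rational boxes; [F c] is the box [c] if it lies in [A], and empty otherwise. *)
Lemma open_measurable_prod (A : set (R * R)) : open A -> measurable A.
Proof.
move=> oA; pose F c := [set p | box c `<=` A /\ box c p].
have -> : A = \bigcup_c F c.
  apply/seteqP; split=> [p Ap|p [c _ [cA /cA]]//].
  have [d d0 dA] := nbhs_box (open_nbhs_nbhs (conj oA Ap)).
  have lt1 (x : R) : x - d < x by rewrite gtrBl.
  have lt2 (x : R) : x < x + d by rewrite ltrDl.
  have [q1 q1P] := rat_in_itvoo (lt1 p.1); have [q2 q2P] := rat_in_itvoo (lt2 p.1).
  have [q3 q3P] := rat_in_itvoo (lt1 p.2); have [q4 q4P] := rat_in_itvoo (lt2 p.2).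
  move: q1P q2P q3P q4P; rewrite !in_itv/= => /andP[u1 u2] /andP[u3 u4] /andP[u5 u6] /andP[u7 u8].
  exists ((q1, q2), (q3, q4)) => //; split; last by split; rewrite /= in_itv/= ?u2 ?u6.
  move=> r [/=]; rewrite !in_itv/= => /andP[r1 r2] /andP[r3 r4].
  have -> : r = p + ((r.1 - p.1) *: direction R 0 + (r.2 - p.2) *: direction R 1).
    by rewrite comb_dir !subrKC; exact: surjective_pairing.
  apply: dA; rewrite ltr_norml; apply/andP; split.
  - by rewrite ltrBrDl (lt_trans u1).
  - by rewrite ltrBlDl (lt_trans r2).
  - by rewrite ltrBrDl (lt_trans u5).
  - by rewrite ltrBlDl (lt_trans r4).
apply: countable_bigcupT_measurable => [|c]; first exact: countableP.
have [cA|cA] := pselect (box c `<=` A).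
  rewrite (_ : F c = box c); first by apply: measurableX; exact: measurable_itv.
  by apply/seteqP; split=> p // [].
by rewrite (_ : F c = set0)//; apply/seteqP; split=> p // [].
Qed.

(* The measurable structure carried by [lebesgue2], which the unifier does not
   identify with the default one on [R * R]. *)
Lemma measurable_disc : measurable (@disc R : set (measurableTypeR R * measurableTypeR R)).
Proof. exact: open_measurable_prod (@open_disc R). Qed.

Lemma continuous_measurable_prod (O : set (R * R)) f : open O ->
  (forall p, O p -> {for p, continuous f}) -> measurable_fun O f.
Proof.
move=> oO cf mO; apply: (measurability _ (measurable_realfun.RGenOInfty.measurableE R)) => //.
move=> /= _ [_ [x ->] <-]; apply: open_measurable_prod.
rewrite openE => p [Op fp]; rewrite /interior; apply: filterI.
  exact: open_nbhs_nbhs (conj oO Op).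
by apply: (cf p Op); apply: open_nbhs_nbhs; split=> //; exact: interval_open.
Qed.

Lemma lebesgue2_disc : (lebesgue2 R (@disc R) < +oo)%E.
Proof.
pose I := `[(-1 : R), 1]%classic.
have le : (lebesgue2 R (@disc R) <= lebesgue2 R (I `*` I))%E.
  apply: le_measure; rewrite ?inE.
  - exact: measurable_disc.
  - by apply: measurableX; exact: measurable_itv.
  - move=> p p1; have [] := norm_le_sq (ltW p1).
    by rewrite !ler_norml => u1 u2; split; rewrite /I/= in_itv.
apply: (le_lt_trans le).
rewrite /lebesgue2 product_measure1E; [|exact: measurable_itv|exact: measurable_itv].
have mI : (@lebesgue_measure R I < +oo)%E.
  by rewrite lebesgue_measure_itv/=; case: ifP => _; rewrite -?EFinD ltry.
apply: lte_mul_pinfty; [exact: measure_ge0| |exact: mI].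
by rewrite ge0_fin_numE; [exact: mI|exact: measure_ge0].
Qed.

Lemma integrable_disc f : (forall p, disc p -> {for p, continuous f}) -> bounded_disc f ->
  (lebesgue2 R).-integrable (@disc R) (EFin \o f).
Proof.
move=> cf [M HM]; apply: measurable_bounded_integrable.
- exact: measurable_disc.
- exact: lebesgue2_disc.
- exact: continuous_measurable_prod (@open_disc R) cf.
- exists M; split; first exact: num_real.
  by move=> y My p p1; apply: (le_trans (HM _ p1)); exact: ltW.
Qed.

Lemma integral_derive_compact (h dh : R -> R) :
  (forall y : R, is_derive y (1 : R) h (dh y)) -> continuous dh ->
  (forall y, 1 <= `|y| -> h y = 0 /\ dh y = 0) ->
  (\int[@lebesgue_measure R]_y (dh y)%:E = 0)%E.
Proof.
move=> Dh cdh h0.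
(* [h] and [dh] vanish for |y| >= 1, so the interval [-2, 2] carries the whole integral and [h] is 0
   at both ends. *)
have -> : (\int[@lebesgue_measure R]_y (dh y)%:E = \int[@lebesgue_measure R]_(y in `[(- 2 : R)%R, 2%R]) (dh y)%:E)%E.
  rewrite [RHS]integral_mkcond; apply: eq_integral => y _.
  rewrite patchE; case: ifPn => // /negP yN.
  have y1 : 1 <= `|y|; last by rewrite (h0 y y1).2.
  rewrite leNgt; apply/negP; rewrite ltr_norml => /andP[y1 y2]; apply: yN.
  by rewrite inE/= in_itv/=; apply/andP; split; lra.
have lt22 : (-2 : R) < 2 by lra.
have ch : continuous h.
  by move=> y; apply: differentiable_continuous; apply/derivable1_diffP; case: (Dh y).
rewrite (continuous_FTC2 (F := h) lt22).
- have h2 : 1 <= `|2 : R| by rewrite ger0_norm//; lra.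
  have hN2 : 1 <= `|- 2 : R| by rewrite normrN.
  by rewrite (h0 _ h2).1 (h0 _ hN2).1 subee.
- by apply: continuous_subspaceT; exact: cdh.
- split.
  + by move=> y _; case: (Dh y).
  + by apply: cvg_at_right_filter; exact: ch.
  + by apply: cvg_at_left_filter; exact: ch.
- by move=> y _; rewrite derive1E; exact: derive_val.
Qed.

(** Fubini, with the variable of the derivative integrated first: the inner integral is that of a
    compactly supported derivative. The gap between [b] and 1 makes the derivative vanish from the
    circle on, so the disc may be replaced by the plane. *)
Lemma integral_partial G j b : b < 1 ->
  (forall p, derivable G p (direction R j)) ->
  (forall p, {for p, continuous (partial j G)}) ->
  (forall p, b <= sq p -> G p = 0) ->
  \int[lebesgue2 R]_(p in @disc R) partial j G p = 0.
Proof.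
move=> b1 dG cG G0.
have zero p : b < sq p -> partial j G p = 0.
  move=> bp; rewrite (partial_ext (U := [set q | b < sq q]) (g := cst 0) j (@open_sq_gt R b) bp).
    by rewrite /partial derive_cst.
  by move=> q /ltW/G0.
have zero1 p : 1 <= sq p -> G p = 0 /\ partial j G p = 0.
  by move=> p1; split; [apply: G0; rewrite ltW// (lt_le_trans b1)|apply: zero; rewrite (lt_le_trans b1)].
have intD : (lebesgue2 R).-integrable (@disc R) (EFin \o partial j G).
  apply: integrable_disc => [p _|]; first exact: cG.
  apply: (@disc_bound _ _ b 0 b1) => [p _|p /andP[bp _]]; first exact: cG.
  by rewrite zero// normr0.
have Fr : (EFin \o partial j G) \_ (@disc R) = EFin \o partial j G.
  apply/funext => p; rewrite patchE; case: ifPn => // /negP pN /=.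
  have p1 : 1 <= sq p; last by rewrite (zero1 p p1).2.
  by rewrite leNgt; apply/negP => p1; apply: pN; rewrite inE.
have intT : (lebesgue2 R).-integrable setT (EFin \o partial j G).
  have := (proj1 (@integrable_mkcond _ _ _ (lebesgue2 R) (@disc R) (EFin \o partial j G) measurable_disc)) intD.
 by rewrite Fr.
rewrite /Rintegral integral_mkcond Fr.
suff -> : (\int[lebesgue2 R]_p (EFin \o partial j G) p = 0)%E by [].
have sq1 (x : R) : 1 <= `|x| -> 1 <= x ^+ 2.
  by move=> x1; rewrite -(real_normK (num_real x)); apply: exprn_ege1.
have L (p : R * R) (y : R) := is_derive_line (dG (p + y *: direction R j)).
case: (boolP (j == 0)) => j0.
  rewrite -(integral21_prod_meas1 intT); apply: integral0_eq => y _.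
  rewrite /fubini_G /=.
  have E x : (0, y) + x *: direction R j = (x, y).
    rewrite (eqP j0) -[X in _ + X]addr0 -(scale0r (direction R 1)) comb_dir/=.
    by rewrite add0r addr0.
  apply: (@integral_derive_compact (fun x => G (x, y)) (fun x => partial j G (x, y))).
  - move=> x; have := L (0, y) x.
    by rewrite E; under [X in is_derive _ _ X]eq_fun do rewrite E.
  - move=> x; apply: (@continuous_comp _ _ _ (fun x => (x, y)) (partial j G)); last exact: cG.
    have -> : (fun x => (x, y)) = (fun x => (0, y) + x *: direction R j) by apply/funext => z; rewrite E.
    by apply: cvgD; [exact: cvg_cst|exact: scalel_continuous].
  - by move=> x /sq1 x1; apply: zero1; rewrite /sq/= (le_trans x1)// lerDl sqr_ge0.
have j1 : j = 1 by case: (j) j0 => [[|[|//]] i2] // _; exact: val_inj.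
subst j.
rewrite -(integral12_prod_meas1 intT); apply: integral0_eq => x _.
rewrite /fubini_F /=.
have E y : (x, 0) + y *: direction R 1 = (x, y).
  rewrite -[X in _ + X]add0r -(scale0r (direction R 0)) comb_dir/=.
  by rewrite add0r addr0.
apply: (@integral_derive_compact (fun y => G (x, y)) (fun y => partial 1 G (x, y))).
- move=> y; have := L (x, 0) y.
  by rewrite E; under [X in is_derive _ _ X]eq_fun do rewrite E.
- move=> y; apply: (@continuous_comp _ _ _ (fun y => (x, y)) (partial 1 G)); last exact: cG.
  have -> : (fun y => (x, y)) = (fun y => (x, 0) + y *: direction R 1) by apply/funext => z; rewrite E.
  by apply: cvgD; [exact: cvg_cst|exact: scalel_continuous].
- by move=> y /sq1 y1; apply: zero1; rewrite /sq/= (le_trans y1)// lerDr sqr_ge0.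
Qed.

End Integration.

(** * Radial cutoffs *)

Section Cutoff.
Variable R : realType.
Implicit Types (F G : R * R -> R) (V W U : vfield R) (p q : R * R) (j : 'I_2) (a c s t : R).

(** The square of the positive part. It is of class C^1 with derivative t + |t|, which is enough for
    one integration by parts. *)
Definition sqpos t : R := ((t + `|t|) / 2) ^+ 2.

Lemma sqpos_le0 t : t <= 0 -> sqpos t = 0.
Proof. by move=> t0; rewrite /sqpos ler0_norm// subrr mul0r expr0n. Qed.

Lemma sqpos_ge0E t : 0 <= t -> sqpos t = t ^+ 2.
Proof. by move=> t0; rewrite /sqpos ger0_norm//; congr (_ ^+ 2); field. Qed.

Lemma is_derive_sqpos t : is_derive t (1 : R) sqpos (t + `|t|).
Proof.
have [t0|t0|->] := ltgtP t 0.
- rewrite ltr0_norm// subrr; apply: (@near_eq_is_derive _ _ _ (cst 0)).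
    have : nbhs t [set x | x < 0] by apply: open_nbhs_nbhs; split; [exact: open_lt|].
    by apply: filterS => x /= /ltW/sqpos_le0 ->.
- rewrite gtr0_norm//; apply: (@near_eq_is_derive _ _ _ (id ^+ 2 : R -> R)).
    have : nbhs t [set x | 0 < x] by apply: open_nbhs_nbhs; split; [exact: open_gt|].
    by apply: filterS => x /= /ltW/sqpos_ge0E ->; rewrite exprfctE.
  by apply: is_derive_eq; rewrite /GRing.scale/= mulr1 expr1 mulr2n mulrDl mul1r.
(* At 0 the difference quotient is 0 for h <= 0 and h for h > 0. *)
- rewrite normr0 addr0.
  suff H : (h^-1 *: ((sqpos \o shift 0) (h *: 1) - sqpos 0)) @[h --> 0^'] --> (0 : R).
    by apply: DeriveDef; [apply/cvg_ex; eexists; exact: H|exact: (cvg_lim _ H)].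
  apply/cvgrPdist_le => /= e e0; near=> h.
  have he : `|h| <= e.
    near: h; apply: nbhs_dnbhs; exists e => // z /=; rewrite /ball/= sub0r normrN; exact: ltW.
  rewrite sub0r normrN /= addr0 (sqpos_le0 (lexx 0)) subr0 /GRing.scale/= mulr1.
  have [h0|h0] := leP h 0; first by rewrite sqpos_le0// mulr0 normr0 ltW.
  by rewrite (sqpos_ge0E (ltW h0)) expr2 mulKf ?gt_eqF.
Unshelve. all: by end_near. Qed.

(** A C^1 cutoff in the squared radius: 1 up to [a], 0 from a + 1/c on. The inner [sqpos] leaves 0
    at [a] and reaches 1 at a + 1/c, where the outer one vanishes together with its derivative. *)
Definition plateau a c s : R := sqpos (1 - sqpos ((s - a) * c)).

Definition dplateau a c s : R :=
  - ((1 - sqpos ((s - a) * c)) + `|1 - sqpos ((s - a) * c)|) * (((s - a) * c + `|(s - a) * c|) * c).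

Lemma is_derive_plateau a c s : is_derive s (1 : R) (plateau a c) (dplateau a c s).
Proof.
have D1 : is_derive s (1 : R) (fun x : R => (x - a) * c) c.
  have : is_derive s (1 : R) ((id - cst a) * cst c : R -> R) c.
    apply: is_derive_eq; rewrite /GRing.scale/= !fctE; ring.
  by [].
have D2 := @is_derive1_comp _ sqpos (fun x : R => (x - a) * c) s _ _ (is_derive_sqpos ((s - a) * c)) D1.
have D3 : is_derive s (1 : R) (fun x : R => 1 - sqpos ((x - a) * c)) (0 - ((s - a) * c + `|(s - a) * c|) * c).
  exact: (is_deriveB (is_derive_cst (1 : R) s (1 : R)) D2).
have D4 := @is_derive1_comp _ sqpos (fun x : R => 1 - sqpos ((x - a) * c)) s _ _ (is_derive_sqpos (1 - sqpos ((s - a) * c))) D3.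
by apply: (is_derive_eq D4); rewrite /dplateau sub0r mulrN mulNr.
Qed.

Lemma sqpos_continuous : continuous sqpos.
Proof.
move=> t; apply: differentiable_continuous; apply/derivable1_diffP.
by case: (is_derive_sqpos t).
Qed.

Lemma plateau_continuous a c : continuous (plateau a c).
Proof.
move=> t; apply: differentiable_continuous; apply/derivable1_diffP.
by case: (is_derive_plateau a c t).
Qed.

Lemma dplateau_continuous a c : continuous (dplateau a c).
Proof.
move=> s.
have c1 : {for s, continuous (fun x : R => (x - a) * c)}.
  by apply: cvgM; [apply: cvgB; [exact: cvg_id|exact: cvg_cst]|exact: cvg_cst].
have c2 : {for s, continuous (fun x : R => 1 - sqpos ((x - a) * c))}.
  apply: cvgB; first exact: cvg_cst.
  exact: (continuous_comp c1 (@sqpos_continuous _)).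
apply: cvgM.
  by apply: cvgN; apply: cvgD; [exact: c2|apply: cvg_norm; exact: c2].
by apply: cvgM; [apply: cvgD; [exact: c1|apply: cvg_norm; exact: c1]|exact: cvg_cst].
Qed.

Lemma plateau_le a c s : 0 < c -> s <= a -> plateau a c s = 1 /\ dplateau a c s = 0.
Proof.
move=> c0 sa; have w0 : (s - a) * c <= 0 by rewrite pmulr_lle0// subr_le0.
rewrite /plateau /dplateau (sqpos_le0 w0) subr0 (sqpos_ge0E ler01) expr1n; split=> //.
by rewrite (ler0_norm w0) subrr mul0r mulr0.
Qed.

Lemma plateau_ge a c s : 0 < c -> a + c^-1 <= s -> plateau a c s = 0.
Proof.
move=> c0 sa; have w1 : 1 <= (s - a) * c by rewrite -ler_pdivrMr// mul1r lerBrDl.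
rewrite /plateau (@sqpos_le0 (1 - _))// sqpos_ge0E ?(le_trans ler01)//.
by rewrite subr_le0 exprn_ege1.
Qed.

Lemma plateau_bound a c s : 0 <= plateau a c s <= 1.
Proof.
rewrite /plateau; set u := 1 - _.
have u1 : u <= 1 by rewrite /u lerBlDl lerDr sqr_ge0.
rewrite sqr_ge0/=; have [u0|/ltW u0] := leP u 0; first by rewrite sqpos_le0.
by rewrite sqpos_ge0E// expr_le1.
Qed.

Lemma partial_plateau a c j p :
  derivable (fun q => plateau a c (sq q)) p (direction R j) /\
  partial j (fun q => plateau a c (sq q)) p = dplateau a c (sq p) * (2 * (if j == 0 then p.1 else p.2)).
Proof.
have Csq := Cinfty_sq (@openT (R * R)%type).
have dsq := Cinfty_derivable (j := j) Csq (I : setT p).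
have psq : partial j (@sq R) p = 2 * (if j == 0 then p.1 else p.2).
  have oT := @openT (R * R)%type.
  have hx := has_partial_refl j p (Cinfty_fst oT); have hy := has_partial_refl j p (Cinfty_snd oT).
  have E q : setT q -> sq q = q.1 * q.1 + q.2 * q.2 by [].
  have := partial_has oT I E (has_partialD oT I (has_partialM oT I hx hx) (has_partialM oT I hy hy)).
  rewrite partial_fst partial_snd => ->; case: (j == 0) => /=; ring.
have p0 : p + 0 *: direction R j = p by rewrite scale0r addr0.
have D1 : is_derive (0 : R) (1 : R) (fun h : R => sq (p + h *: direction R j)) (partial j (@sq R) p).
  by have := @is_derive_line _ (@sq R) p (direction R j) 0; rewrite p0; apply.
have D2 : is_derive (0 : R) (1 : R) (fun h : R => plateau a c (sq (p + h *: direction R j)))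
    (dplateau a c (sq p) * partial j (@sq R) p).
  apply: (@is_derive1_comp _ (plateau a c) (fun h : R => sq (p + h *: direction R j)) 0 _ _ _ D1).
  by rewrite p0; exact: is_derive_plateau.
have E : (fun h : R => h^-1 *: (((fun h : R => plateau a c (sq (p + h *: direction R j))) \o shift 0) (h *: 1)
      - plateau a c (sq (p + 0 *: direction R j))))
    = (fun h : R => h^-1 *: (((fun q => plateau a c (sq q)) \o shift p) (h *: direction R j) - plateau a c (sq p))).
  apply/funext => h /=; rewrite p0 addr0; congr (_ *: (plateau a c (sq _) - _)).
  by rewrite /GRing.scale/= mulr1 addrC.
case: D2 => D2 D3; split; first by move: D2; rewrite /derivable E.
by move: D3; rewrite /derive E psq.
Qed.

(** [D] is the derivative of the cutoff times F. This product is 0 from the squared radius b < 1 on,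
    so its derivative exists and is continuous on the whole plane, whatever F is outside the
    disc. *)
Lemma integral_cutoff a c F j : 0 < c -> a + c^-1 < 1 -> Cinfty (@disc R) F ->
  let D p := dplateau a c (sq p) * (2 * (if j == 0 then p.1 else p.2)) * F p
     + plateau a c (sq p) * partial j F p in
  (lebesgue2 R).-integrable (@disc R) (EFin \o D) /\
  \int[lebesgue2 R]_(p in @disc R) D p = 0.
Proof.
move=> c0 b1 CF D; set b := a + c^-1 in b1 *.
pose G p := plateau a c (sq p) * F p.
have oD := @open_disc R.
have G0 p : b <= sq p -> G p = 0 by move=> bp; rewrite /G plateau_ge// mul0r.
have dF p (p1 : disc p) := Cinfty_derivable (j := j) CF p1.
have dG1 p : disc p -> derivable G p (direction R j).
  by move=> p1; apply: derivableM; [exact: (partial_plateau a c j p).1|exact: dF].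
have pG1 p : disc p -> partial j G p = D p.
  move=> p1; rewrite /G partialM; [|exact: (partial_plateau a c j p).1|exact: dF].
  by rewrite (partial_plateau a c j p).2 addrC (mulrC (F p)).
have oB := @open_sq_gt R b.
have zero p : b < sq p -> forall q, [set q | b < sq q] q -> G q = cst 0 q by move=> _ q /ltW/G0.
have cov p : disc p \/ b < sq p.
  have [p1|p1] := boolP (sq p < 1); [by left|right].
  by rewrite (lt_le_trans b1)// leNgt.
have dG p : derivable G p (direction R j).
  have [p1|bp] := cov p; first exact: dG1.
  have z q : [set q | b < sq q] q -> cst 0 q = G q by move=> /ltW/G0 ->.
  exact: (derivable_ext oB bp z (derivable_cst _ _ _)).
have cD p : disc p -> {for p, continuous D}.
  move=> p1; apply: cvgD; apply: cvgM.
  - apply: cvgM; first exact: (continuous_comp (@sq_continuous R p) (@dplateau_continuous a c _)).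
    apply: cvgM; first exact: cvg_cst.
    by case: (j == 0); [exact: continuous_fst_at|exact: continuous_snd_at].
  - exact: Cinfty_continuous CF p1.
  - exact: (continuous_comp (@sq_continuous R p) (@plateau_continuous a c _)).
  - exact: Cinfty_continuous (Cinfty_partial j CF) p1.
have pG0 p : b < sq p -> partial j G p = 0.
  move=> bp; rewrite (partial_ext j oB bp (zero p bp)).
  by rewrite /partial derive_cst.
have cG p : {for p, continuous (partial j G)}.
  have [p1|bp] := cov p.
    by apply: (continuous_ext oD p1 _ (cD p p1)) => q q1; rewrite pG1.
  apply: (continuous_ext (f := cst 0) oB bp); last exact: cvg_cst.
  by move=> q bq; rewrite pG0.
have bD : bounded_disc D.
  apply: (@disc_bound _ D b 0 b1 cD) => p bp.
  have p1 := @ann_disc R b p bp; case/andP: bp => bp _.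
  by rewrite -pG1// pG0// normr0.
split; first exact: integrable_disc.
rewrite -(integral_partial b1 dG cG G0); apply: eq_Rintegral => p; rewrite inE => p1.
by rewrite pG1.
Qed.

End Cutoff.

(** * The cocycle *)

Section Cocycle.
Variable R : realType.
Implicit Types (f : R * R -> R) (V W U : vfield R) (p q : R * R) (i j k : 'I_2) (a s : R).

Lemma integrable_density V W : GVect_ar V -> GVect_ar W ->
  (lebesgue2 R).-integrable (@disc R) (EFin \o Gbeta_density V W).
Proof.
move=> gV gW; have [_ sV _] := (GVect_arP V).1 gV; have [_ sW _] := (GVect_arP W).1 gW.
apply: integrable_disc; last exact: density_bounded.
by move=> p p1; exact: Cinfty_continuous (Cinfty_density sV sW) p1.
Qed.

Lemma radial_common V W U : GVect_ar V -> GVect_ar W -> GVect_ar U ->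
  exists2 a, 0 <= a < 1 & [/\ radial a V, radial a W & radial a U].
Proof.
move=> /GVect_arP[_ _ [a /andP[a0 a1] rV]] /GVect_arP[_ _ [b /andP[b0 b1] rW]].
move=> /GVect_arP[_ _ [c /andP[c0 c1] rU]].
exists (Num.max a (Num.max b c)); first by rewrite le_max a0 !gt_max a1 b1.
by split; [apply: radial_sub rV|apply: radial_sub rW|apply: radial_sub rU]; rewrite !le_max lexx ?orbT.
Qed.

(** The assumed integrability makes |div F| the dominating function, for cutoffs with values in
    [0, 1]. *)
Lemma integral_divergence_flux V W U : GVect_ar V -> GVect_ar W -> GVect_ar U ->
  (lebesgue2 R).-integrable (@disc R)
    (EFin \o (fun p => partial 0 (flux V W U 0) p + partial 1 (flux V W U 1) p)) ->
  \int[lebesgue2 R]_(p in @disc R) (partial 0 (flux V W U 0) p + partial 1 (flux V W U 1) p) = 0.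
Proof.
move=> gV gW gU; set dv := fun p => _ + _ => idv.
have [_ sV _] := (GVect_arP V).1 gV; have [_ sW _] := (GVect_arP W).1 gW.
have [_ sU _] := (GVect_arP U).1 gU.
have [a /andP[a0 a1] [rV rW rU]] := radial_common gV gW gU.
have mD := @measurable_disc R.
have CF m := Cinfty_flux m sV sW sU.
(* The cutoff [h n] falls from 1 to 0 for 1 - d < |p|^2 < 1 - d/2, a layer inside the common annulus
   that shrinks to the circle. *)
pose d (n : nat) := (1 - a) / n.+2%:R.
have d0 n : 0 < d n by rewrite divr_gt0// subr_gt0.
have da n : a <= 1 - d n.
  rewrite lerBrDl -lerBrDr /d ler_pdivrMr// ler_peMr ?subr_ge0 ?(ltW a1)//.
  by rewrite ler1n.
pose h n p := plateau (1 - d n) (2 / d n) (sq p).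
have cn n : 0 < 2 / d n by rewrite divr_gt0.
have bn n : 1 - d n + (2 / d n)^-1 < 1.
  rewrite invf_div -addrA gtrDl addrC subr_lt0 ltr_pdivrMr//.
  by rewrite ltr_pMr// ltr1n.
have G n : (lebesgue2 R).-integrable (@disc R) (EFin \o (fun p => h n p * dv p)) /\
    \int[lebesgue2 R]_(p in @disc R) (h n p * dv p) = 0.
  have [i0 I0] := integral_cutoff 0 (cn n) (bn n) (CF 0).
  have [i1 I1] := integral_cutoff 1 (cn n) (bn n) (CF 1).
  set D0 := (X in EFin \o X) in i0; set D1 := (X in EFin \o X) in i1.
  have E p : disc p -> D0 p + D1 p = h n p * dv p.
    move=> p1; rewrite /D0 /D1 /h /dv /=.
    (* The cutoff has derivative 0 for [sq p <= 1 - d n]; beyond, p lies in the annulus and F is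
       orthogonal to p. *)
    have T : dplateau (1 - d n) (2 / d n) (sq p) * (p.1 * flux V W U 0 p + p.2 * flux V W U 1 p) = 0.
      have [sp|sp] := leP (sq p) (1 - d n).
        by rewrite (plateau_le (cn n) sp).2 mul0r.
      by rewrite (flux_tangent a0 sV sW sU rV rW rU) ?mulr0// /ann/= (le_lt_trans (da n) sp).
    have alg (k x y F0 F1 z e0 e1 : R) : k * (x * F0 + y * F1) = 0 ->
        k * (2 * x) * F0 + z * e0 + (k * (2 * y) * F1 + z * e1) = z * (e0 + e1).
      move=> K; transitivity (2 * (k * (x * F0 + y * F1)) + z * (e0 + e1)); first by ring.
      by rewrite K mulr0 add0r.
    exact: alg T.
  split.
    apply: (@eq_integrable _ _ _ (lebesgue2 R) _ mD _ _ _ (integrableD mD i0 i1)) => p.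
    by rewrite inE => p1; rewrite /= -EFinD E.
  transitivity (\int[lebesgue2 R]_(p in @disc R) (D0 p + D1 p)).
    by apply: eq_Rintegral => p; rewrite inE => p1; rewrite E.
  by rewrite RintegralD// I0 I1 addr0.
(* At a fixed p the sequence is eventually constant: h = 1 as soon as d <= 1 - |p|^2. *)
have hcvg p : disc p -> (EFin \o (fun p => h n p * dv p)) p @[n --> \oo] --> (EFin \o dv) p.
  move=> p1; apply: cvg_near_cst.
  have p1' : 0 < 1 - sq p by rewrite subr_gt0.
  near=> n; rewrite /= /h (plateau_le (cn n) _).1 ?mul1r//.
  rewrite lerBrDl -lerBrDr /d ler_pdivrMr// mulrC -ler_pdivrMr//.
  apply: (@le_trans _ _ n%:R); last by rewrite ler_nat; exact: (leq_trans (leqnSn _) (leqnSn _)).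
  by near: n; exact: nbhs_infty_ger.
have hle p n : disc p -> (`|(EFin \o (fun p => (h n p * dv p)%R)) p| <= (abse \o (EFin \o dv)) p)%E.
  move=> p1; rewrite /= lee_fin normrM ler_piMl//.
  by have /andP[h0 h1] := plateau_bound (1 - d n) (2 / d n) (sq p); rewrite /h ger0_norm.
have ae1 : {ae lebesgue2 R, forall p, disc p ->
    (EFin \o (fun p => h n p * dv p)) p @[n --> \oo] --> (EFin \o dv) p}.
  by apply: aeW => p; exact: hcvg.
have ae2 : {ae lebesgue2 R, forall p n, disc p ->
    (`|(EFin \o (fun p => (h n p * dv p)%R)) p| <= (abse \o (EFin \o dv)) p)%E}.
  by apply: aeW => p n; exact: hle.
have [_ _ lim] := @dominated_convergence _ _ R (lebesgue2 R) (@disc R) mD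
  (fun n => EFin \o (fun p => h n p * dv p)) (EFin \o dv) (abse \o (EFin \o dv))
  (fun n => measurable_int _ (G n).1) (measurable_int _ idv)
  ae1 (integrable_abse idv) ae2.
have I0 : (\int[lebesgue2 R]_(p in @disc R) (EFin \o dv) p = 0)%E.
  apply/esym; move: lim; rewrite (_ : (fun n => _) = cst 0%E).
    by move/cvg_lim => <- //; rewrite lim_cst.
  apply/funext => n /=; have [iG IG] := G n.
  by rewrite -(fineK (integrable_fin_num mD iG)); congr EFin; exact: IG.
by rewrite /Rintegral I0.
Unshelve. all: by end_near. Qed.

(** Brackets stay in the algebra, so the three densities are integrable one by one; this gives the
    integrability of their sum, which is div F. *)
Lemma integral_cyclic V W U : GVect_ar V -> GVect_ar W -> GVect_ar U ->
  \int[lebesgue2 R]_(p in @disc R) Gbeta_density (bracket V W) U p +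
  \int[lebesgue2 R]_(p in @disc R) Gbeta_density (bracket W U) V p +
  \int[lebesgue2 R]_(p in @disc R) Gbeta_density (bracket U V) W p = 0.
Proof.
move=> gV gW gU.
have [_ sV _] := (GVect_arP V).1 gV; have [_ sW _] := (GVect_arP W).1 gW.
have [_ sU _] := (GVect_arP U).1 gU.
have mD := @measurable_disc R.
have i1 := integrable_density (GVect_bracket gV gW) gU.
have i2 := integrable_density (GVect_bracket gW gU) gV.
have i3 := integrable_density (GVect_bracket gU gV) gW.
have i12 := integrableD mD i1 i2; have i123 := integrableD mD i12 i3.
rewrite -(RintegralD mD i1 i2) -(RintegralD mD i12 i3).
have E p : disc p -> _ := @cyclic_divergence R V W U p sV sW sU.
transitivity (\int[lebesgue2 R]_(p in @disc R) (partial 0 (flux V W U 0) p + partial 1 (flux V W U 1) p)).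
  by apply: eq_Rintegral => p; rewrite inE => p1; exact: E.
apply: integral_divergence_flux => //.
apply: (@eq_integrable _ _ _ (lebesgue2 R) _ mD _ _ _ i123) => p; rewrite inE => p1.
by rewrite /= -!EFinD E.
Qed.

(** * Skew-symmetry and bilinearity *)

Lemma wedge2C (u w : 'I_2 -> 'I_2 -> 'I_2 -> R) : wedge2 u w = -1 * wedge2 w u.
Proof. by rewrite /wedge2; ring. Qed.

Lemma wedge2_linl c (u v w : 'I_2 -> 'I_2 -> 'I_2 -> R) :
  wedge2 (fun i j k => c * u i j k + v i j k) w = c * wedge2 u w + wedge2 v w.
Proof. by rewrite /wedge2; ring. Qed.

(** The trace is cyclic and 1-forms anticommute. The sign is a factor -1 so that it leaves the
    integral by [RintegralZl]. *)
Lemma densityC V W p : Gbeta_density V W p = -1 * Gbeta_density W V p.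
Proof.
exact: etrans (densityE2 V W p)
  (etrans (wedge2C _ _) (congr1 ( *%R (-1)) (esym (densityE2 W V p)))).
Qed.

Lemma Gbeta_skew c0 V W : GVect_ar V -> GVect_ar W -> Gbeta c0 V W = - Gbeta c0 W V.
Proof.
move=> gV gW; rewrite /Gbeta -mulrN; congr (_ * _).
transitivity (\int[lebesgue2 R]_(p in @disc R) (-1 * Gbeta_density W V p)).
  by apply: eq_Rintegral => p _; exact: densityC.
by rewrite (RintegralZl _ (@measurable_disc R) (integrable_density gW gV)) mulN1r.
Qed.

Lemma d2_lin c V W i j k p : smooth V -> smooth W -> disc p ->
  d2 (c *: (V : R * R -> 'rV[R]_2) + W) i j k p = c * d2 V i j k p + d2 W i j k p.
Proof.
move=> sV sW p1; have oD := @open_disc R.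
have lin f (g : R * R -> R) l q : disc q -> Cinfty (@disc R) f -> Cinfty (@disc R) g ->
    has_partial (@disc R) (fun r => c * f r + g r) l q (c * partial l f q + partial l g q).
  move=> q1 Cf Cg.
  have := has_partialD oD q1 (has_partialM oD q1 (has_partial_refl l q (Cinfty_cst c oD))
    (has_partial_refl l q Cf)) (has_partial_refl l q Cg).
  have -> : partial l (fun=> c) q = 0 by rewrite /partial derive_cst.
  by rewrite mul0r add0r.
have E1 q : disc q -> partial j (vcomp (c *: (V : R * R -> 'rV[R]_2) + W) i) q =
    c * partial j (vcomp V i) q + partial j (vcomp W i) q.
  move=> q1; exact: (partial_has oD q1 (fun r _ => vcompD c V W i r) (lin _ _ j q q1 (sV i) (sW i))).
exact: (partial_has oD p1 E1 (lin _ _ k p p1 (Cinfty_partial j (sV i)) (Cinfty_partial j (sW i)))).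
Qed.

Lemma density_linl c U V W p : smooth U -> smooth V -> disc p ->
  Gbeta_density (c *: (U : R * R -> 'rV[R]_2) + V) W p = c * Gbeta_density U W p + Gbeta_density V W p.
Proof.
move=> sU sV p1; apply: etrans (densityE2 _ W p) _.
apply: etrans (wedge2_eq (fun i j k => d2_lin c i j k sU sV p1) (fun i j k => erefl _)) _.
apply: etrans (wedge2_linl c _ _ _) _.
exact: esym (congr2 +%R (congr1 ( *%R c) (densityE2 U W p)) (densityE2 V W p)).
Qed.

Lemma Gbeta_linl c0 c U V W : GVect_ar U -> GVect_ar V -> GVect_ar W ->
  Gbeta c0 (c *: (U : R * R -> 'rV[R]_2) + V) W = c * Gbeta c0 U W + Gbeta c0 V W.
Proof.
move=> gU gV gW; have mD := @measurable_disc R.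
have [_ sV _] := (GVect_arP V).1 gV; have [_ sU _] := (GVect_arP U).1 gU.
have iU := integrable_density gU gW; have iV := integrable_density gV gW.
have icU : (lebesgue2 R).-integrable (@disc R) (EFin \o (fun p => c * Gbeta_density U W p)).
  exact: (integrableZl mD c iU).
have E : \int[lebesgue2 R]_(p in @disc R) Gbeta_density (c *: (U : R * R -> 'rV[R]_2) + V) W p =
    c * (\int[lebesgue2 R]_(p in @disc R) Gbeta_density U W p) +
    \int[lebesgue2 R]_(p in @disc R) Gbeta_density V W p.
  transitivity (\int[lebesgue2 R]_(p in @disc R) (c * Gbeta_density U W p + Gbeta_density V W p)).
    by apply: eq_Rintegral => p; rewrite inE => p1; exact: density_linl.
  exact: etrans (RintegralD mD icU iV) (congr2 +%R (RintegralZl _ mD iU) erefl).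
have alg (k x y : R) : k * (c * x + y) = c * (k * x) + k * y by ring.
exact: etrans (congr1 ( *%R (- 6 * c0)) E) (alg _ _ _).
Qed.

Lemma lie_2cocycle_Gbeta c0 : lie_2cocycle (@GVect_ar R) (Gbeta c0).
Proof.
split.
- exact: Gbeta_skew.
- exact: Gbeta_linl.
(* Linearity on the right is linearity on the left conjugated by skew-symmetry. *)
- move=> c U V W gU gV gW.
  have alg (x y : R) : - (c * x + y) = c * (- x) + (- y) by ring.
  apply: etrans (Gbeta_skew c0 gW (GVect_lin c gU gV)) _.
  apply: etrans (congr1 -%R (Gbeta_linl c0 c gU gV gW)) _.
  apply: etrans (alg _ _) _.
  exact: esym (congr2 +%R (congr1 ( *%R c) (Gbeta_skew c0 gW gU)) (Gbeta_skew c0 gW gV)).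
- move=> V W U gV gW gU.
  have alg (k x y z : R) : k * x + k * y + k * z = k * (x + y + z) by ring.
  apply: etrans (alg (- 6 * c0) _ _ _) _.
  exact: etrans (congr1 ( *%R (- 6 * c0)) (integral_cyclic gV gW gU)) (mulr0 _).
Qed.

End Cocycle.

Unset Implicit Arguments.

(** The integral is a total operation, so the integrability of the density is asserted as well,
    which makes [Gbeta] a genuine integral; the first clause makes the domain of the cocycle a Lie
    algebra. *)
Theorem proposition6p24 (R : realType) (c0 : R) :
  lie_subalgebra (@GVect_ar R) /\
  (forall V W : vfield R, GVect_ar V -> GVect_ar W ->
     (lebesgue2 R).-integrable (@disc R) (fun p => (Gbeta_density V W p)%:E)) /\
  lie_2cocycle (@GVect_ar R) (Gbeta c0).
Proof.
split; first exact: lie_subalgebra_GVect.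
split; first exact: integrable_density.
exact: lie_2cocycle_Gbeta.
Qed.
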